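(* If $\mathcal C$ is a discrete simplicial category (i.e. a category in the usual sense), then $\mathcal C$ cannot have the general cup product formula in cobordism.
   Context: **Simplicial categories.** A simplicial category $\mathcal C$ is a category enriched in simplicial sets, with mapping spaces $\mathrm{Map}_{\mathcal C}(-,-)$; it is discrete if all mapping spaces are sets. All limits are homotopy limits: $X$ is homotopy terminal if every $\mathrm{Map}(Y,X)$ is contractible; $A\times_BC$ is a homotopy pullback if $\mathrm{Map}(X,A\times_BC)\to \mathrm{Map}(X,A)\times^h_{\mathrm{Map}(X,B)}\mathrm{Map}(X,C)$ is a weak equivalence for all $X$ (in the discrete case: ordinary terminal objects, pullbacks and isomorphisms). $\mathbf{Man}$ is the (discrete) category of smooth manifolds; $\mathbf{CG}$ is the (discrete) category of compactly generated Hausdorff spaces. **Geometric.** A simplicial category $\mathcal C$ is geometric if: (1) all mapping spaces are Kan complexes; (2) there is a fully faithful functor $\mathbf i:\mathbf{Man}\to\mathcal C$ (objects in its essential image are called manifolds; one writes $M$ for $\mathbf i(M)$); (3) if $A\to M$, $B\to M$ are transverse maps of manifolds, then $\mathbf i(A)\times_{\mathbf i(M)}\mathbf i(B)$ exists in $\mathcal C$ and the natural map $\mathbf i(A\times_MB)\to \mathbf i(A)\times_{\mathbf i(M)}\mathbf i(B)$ is an equivalence, and $\mathbf i(\mathbb R^0)$ is homotopy terminal; (4) there is a functor $\mathbf U:\mathcal C\to\mathbf{CG}$ (underlying space) with $\mathbf U\circ\mathbf i$ the usual underlying space functor, commuting with finite limits when they exist. Topological adjectives applied to objects or maps of $\mathcal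 C$ refer to their images under $\mathbf U$. **General cup product formula.** A simplicial category $\mathcal C$ has the general cup product formula in cobordism if: (1) $\mathcal C$ is geometric; (2) for any manifold $M$ and submanifolds $A,B\subset M$ (possibly not transverse) a homotopy pullback $A\cap B:=A\times_MB$ exists in $\mathcal C$ (the derived intersection); (3) there is an equivalence relation on the compact objects of $\mathcal C$, called derived cobordism, extending the cobordism relation on manifolds; that is, for any manifold $T$ there is a ring $\Omega^{der}(T)$, the derived cobordism ring over $T$, and $\mathbf i$ induces a homomorphism of cobordism rings $\mathbf i_*:\Omega(T)\to\Omega^{der}(T)$ (where $\Omega(T)$ is the classical unoriented cobordism ring over $T$), and $\mathbf i_*$ is injective; (4) if $A,B$ are compact submanifolds of a manifold $M$, then $[A]\smile[B]=[A\cap B]$ in $\Omega^{der}(M)$, where $[-]$ takes a compact derived submanifold of $M$ to its class in $\Omega^{der}(M)$ and $\smile$ is the multiplication of that ring. *)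

(* Defs.v *)
From HB Require Import structures.
From mathcomp Require Import all_boot all_order all_algebra.
From mathcomp Require Import all_classical all_reals.
From mathcomp Require Import topology normedtype landau derive.

Set Implicit Arguments.
Unset Strict Implicit.
Unset Printing Implicit Defensive.

Import Order.TTheory GRing.Theory Num.Theory.
Import numFieldNormedType.Exports.

Local Open Scope classical_set_scope.
Local Open Scope ring_scope.

(* C^k on an open set U, in finite dimension. *)
Fixpoint Ck (R : realType) (V W : normedModType R) (k : nat) (U : set V)
    (f : V -> W) : Prop :=
  match k with
  | 0%N => forall x, U x -> {for x, continuous f}
  | k'.+1 => (forall x, U x -> differentiable f x) /\
             forall v : V, Ck k' U (fun x => 'd f x v)
  end.

(* Smoothness on an arbitrary S (in particular, on an open subset of a
   half-space): local existence of smooth extensions. *)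
Definition smooth_on (R : realType) (V W : normedModType R) (S : set V)
    (f : V -> W) : Prop :=
  forall x, S x -> exists U : set V, exists g : V -> W,
    [/\ open U, U x, forall k, Ck k U g & forall y, S y -> U y -> f y = g y].

Section CkTheory.
Variable R : realType.

Lemma near_diff (V W : normedModType R) (f g : V -> W) (x : V) :
  (\forall y \near x, f y = g y) -> differentiable f x ->
  differentiable g x /\ 'd g x = 'd f x :> (V -> W).
Proof.
move=> fg df.
have fgx : f x = g x by exact: nbhs_singleton fg.
have H : g \o shift x = cst (g x) + 'd f x +o_ 0 id.
  apply: eqaddoE; apply/eqaddoP => e e0.
  have /diff_locally/eqaddoP/(_ e e0) H := df.
  have fg0 : \forall y \near (0 : V), f (y + x) = g (y + x).
    by move: fg; rewrite (near_shift 0 x) /= subr0.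
  near=> y.
  have -> : (g \o shift x - (cst (g x) + 'd f x)) y =
            (f \o shift x - (cst (f x) + 'd f x)) y.
    rewrite !fctE /= fgx; congr (_ - _).
    by symmetry; near: y.
  by near: y.
have dgE : 'd g x = 'd f x :> (V -> W).
  by apply: diff_unique => //; exact: diff_continuous df.
split=> //; apply/diff_locallyP; rewrite dgE; split=> //.
exact: diff_continuous df.
Unshelve. all: by end_near. Qed.

Lemma Ck_eq (V W : normedModType R) k (U : set V) : open U ->
  forall f g : V -> W, (forall x, U x -> f x = g x) -> Ck k U f -> Ck k U g.
Proof.
move=> oU; elim: k => [|k IH] f g fg /=.
  move=> cf x Ux; rewrite /prop_for /continuous_at -(fg _ Ux).
  have E : {near x, f =1 g}.
    by move: (open_nbhs_nbhs (conj oU Ux)); apply: filterS => y /fg.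
  by apply: cvg_trans (cf x Ux); apply: near_eq_cvg.
have E x : U x -> {near x, f =1 g}.
  by move=> Ux; move: (open_nbhs_nbhs (conj oU Ux)); apply: filterS => y /fg.
move=> [df dk]; split=> [x Ux|v].
  by have [] := near_diff (E x Ux) (df x Ux).
apply: IH (dk v) => x Ux.
by have [_ ->] := near_diff (E x Ux) (df x Ux).
Qed.

Lemma Ck_sub (V W : normedModType R) k (U U' : set V) : U' `<=` U ->
  forall f : V -> W, Ck k U f -> Ck k U' f.
Proof.
move=> sU; elim: k => [|k IH] f /=; first by move=> cf x /sU /cf.
by move=> [df dk]; split=> [x /sU /df|v] //; apply: IH.
Qed.

Lemma Ck_leS (V W : normedModType R) k (U : set V) :
  forall f : V -> W, Ck k.+1 U f -> Ck k U f.
Proof.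
elim: k => [|k IH] f.
  by move=> [df _] x Ux; apply: differentiable_continuous; apply: df.
by move=> [df dk]; split=> // v; apply: IH; apply: dk.
Qed.

Lemma Ck_cst (V W : normedModType R) k (U : set V) (a : W) :
  open U -> Ck k U (fun _ : V => a).
Proof.
move=> oU; elim: k a => [|k IH] a /=; first by move=> x _; exact: cst_continuous.
split=> [x _|v]; first exact: differentiable_cst.
by apply: Ck_eq (IH 0) => // x _; rewrite diff_cst.
Qed.

Lemma Ck_add (V W : normedModType R) k (U : set V) : open U ->
  forall f g : V -> W, Ck k U f -> Ck k U g -> Ck k U (fun x => f x + g x).
Proof.
move=> oU; elim: k => [|k IH] f g.
  by move=> cf cg x Ux; apply: continuousD; [exact: cf|exact: cg].
move=> [df dkf] [dg dkg]; split=> [x Ux|v].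
  by apply: differentiableD; [exact: df|exact: dg].
apply: Ck_eq (IH _ _ (dkf v) (dkg v)) => // x Ux.
by rewrite -[fun x => f x + g x]/(f + g) diffD //; [exact: df|exact: dg].
Qed.

Lemma Ck_sum (V W : normedModType R) k (U : set V) n (F : 'I_n -> V -> W) :
  open U -> (forall i, Ck k U (F i)) -> Ck k U (fun x => \sum_i F i x).
Proof.
move=> oU; elim: n F => [|n IH] F CF.
  by apply: Ck_eq (Ck_cst k 0 oU) => // x _; rewrite big_ord0.
pose G x := F ord0 x + \sum_i F (lift ord0 i) x.
apply: (@Ck_eq _ _ _ _ oU G); first by move=> x _; rewrite big_ord_recl.
by apply: Ck_add => //; apply: IH => i; exact: CF.
Qed.

Lemma Ck_mul (V : normedModType R) k (U : set V) : open U ->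
  forall f g : V -> R, Ck k U f -> Ck k U g -> Ck k U (fun x => f x * g x).
Proof.
move=> oU; elim: k => [|k IH] f g.
  by move=> cf cg x Ux; apply: continuousM; [exact: cf|exact: cg].
move=> Cf Cg; move: (Cf) (Cg) => [df dkf] [dg dkg]; split=> [x Ux|v].
  by apply: differentiableM; [exact: df|exact: dg].
apply: Ck_eq (Ck_add oU (IH _ _ (Ck_leS Cf) (dkg v))
                        (IH _ _ (Ck_leS Cg) (dkf v))) => // x Ux.
by rewrite -[fun x => f x * g x]/(f * g) diffM //; [exact: df|exact: dg].
Qed.

Lemma Ck_lin (V W X : normedModType R) k (U : set V) (L : {linear W -> X}) :
  open U -> continuous L ->
  forall f : V -> W, Ck k U f -> Ck k U (fun x => L (f x)).
Proof.
move=> oU cL; elim: k => [|k IH] f.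
  move=> cf x Ux; apply: (@continuous_comp _ _ _ f L); first exact: cf.
  exact: cL.
move=> [df dk].
have dL y : differentiable L y by exact: linear_differentiable.
split=> [x Ux|v]; first by apply: differentiable_comp => //; exact: df.
apply: Ck_eq (IH _ (dk v)) => // x Ux.
have dLE : 'd L (f x) = L :> (W -> X) by exact: diff_lin.
have -> : 'd (fun x => L (f x)) x = 'd L (f x) \o 'd f x :> (V -> X).
  by apply: (@diff_comp _ _ _ _ f L); [exact: df|exact: dL].
by rewrite /= dLE.
Qed.

Lemma continuous_row_coord n (i : 'I_n) :
  continuous (fun x : 'rV[R]_n => x 0 i).
Proof. exact: coord_continuous. Qed.

Definition row_coord n (i : 'I_n) (x : 'rV[R]_n) : R^o := x 0 i.

Lemma row_coord_is_linear n (i : 'I_n) : linear (@row_coord n i).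
Proof. by move=> a x y; rewrite /row_coord !mxE. Qed.

HB.instance Definition _ n (i : 'I_n) :=
  GRing.isLinear.Build R 'rV[R]_n R^o *:%R (@row_coord n i)
    (@row_coord_is_linear n i).

Lemma Ck_coord (V : normedModType R) n k (U : set V) (f : V -> 'rV[R]_n) i :
  open U -> Ck k U f -> Ck k U (fun x => f x 0 i).
Proof.
move=> oU; apply: (@Ck_lin _ _ R^o k U (@row_coord n i)) => //.
exact: continuous_row_coord.
Qed.

Lemma Ck_scalel (V W : normedModType R) k (U : set V) (w : W) (f : V -> R) :
  open U -> Ck k U f -> Ck k U (fun x => f x *: w).
Proof.
move=> oU; elim: k f => [|k IH] f.
  by move=> cf x Ux; apply: (@continuousZr_tmp _ _ _ f w x); exact: cf.
move=> [df dk]; split=> [x Ux|v].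
  exact: differentiableZl (df x Ux).
apply: Ck_eq (IH _ (dk v)) => // x Ux.
by rewrite diffZl //; exact: df.
Qed.

Lemma Ck_rowP (V : normedModType R) n k (U : set V) (f : V -> 'rV[R]_n) :
  open U -> (forall i, Ck k U (fun x => f x 0 i)) -> Ck k U f.
Proof.
move=> oU Cf.
apply: (@Ck_eq _ _ _ _ oU (fun x => \sum_i f x 0 i *: delta_mx 0 i)).
  by move=> x _; rewrite -row_sum_delta.
by apply: Ck_sum => // i; exact: Ck_scalel.
Qed.

Lemma Ck_comp (V : normedModType R) n m k (U : set V) (U' : set 'rV[R]_n)
    (f : V -> 'rV[R]_n) (g : 'rV[R]_n -> 'rV[R]_m) :
  open U -> open U' -> (forall x, U x -> U' (f x)) ->
  Ck k U f -> Ck k U' g -> Ck k U (g \o f).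
Proof.
move=> oU oU' UU'; elim: k m g => [|k IH] m g.
  by move=> cf cg x Ux; apply: continuous_comp; [exact: cf|apply/cg/UU'].
move=> Cf Cg; move: (Cf) (Cg) => [df dkf] [dg dkg]; split=> [x Ux|v].
  by apply: differentiable_comp; [exact: df|apply/dg/UU'].
apply: (@Ck_eq _ _ _ _ oU (fun x => 'd g (f x) ('d f x v))).
  move=> x Ux.
  have -> : 'd (g \o f) x = 'd g (f x) \o 'd f x :> (V -> 'rV[R]_m).
    by apply: diff_comp; [exact: df|apply/dg/UU'].
  by [].
apply: Ck_rowP => // j.
apply: (@Ck_eq _ _ _ _ oU
  (fun x => \sum_i ('d f x v) 0 i * ('d g (f x) (delta_mx 0 i)) 0 j)).
  move=> x Ux; rewrite {2}(row_sum_delta ('d f x v)) linear_sum summxE.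
  by apply: eq_bigr => i _; rewrite linearZ mxE.
apply: Ck_sum => // i; apply: Ck_mul => //; first by apply: (@Ck_coord _ _ k U (fun x => 'd f x v)) => //; exact: dkf.
apply: (@Ck_coord _ _ k U (fun x => 'd g (f x) (delta_mx 0 i))) => //.
by apply: (IH _ (fun y => 'd g y (delta_mx 0 i))); [exact: Ck_leS|exact: dkg].
Qed.

End CkTheory.

Record category : Type := Category {
  ob :> Type;
  mor : ob -> ob -> Type;
  mor_id : forall a, mor a a;
  cmp : forall a b c, mor b c -> mor a b -> mor a c;
  cmp_id_l : forall a b (f : mor a b), cmp (mor_id b) f = f;
  cmp_id_r : forall a b (f : mor a b), cmp f (mor_id a) = f;
  cmpA : forall a b c d (h : mor c d) (g : mor b c) (f : mor a b),
    cmp h (cmp g f) = cmp (cmp h g) f }.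

Arguments mor {c0} _ _.
Arguments mor_id {c0} _.
Arguments cmp {c0 a b c} _ _.

Record functor (C D : category) : Type := Functor {
  fob :> C -> D;
  fmor : forall a b : C, mor a b -> mor (fob a) (fob b);
  fmor_id : forall a : C, fmor (mor_id a) = mor_id (fob a);
  fmor_cmp : forall (a b c : C) (g : mor b c) (f : mor a b),
    fmor (cmp g f) = cmp (fmor g) (fmor f) }.

Arguments fmor {C D} _ {a b} _.

Definition fully_faithful (C D : category) (F : functor C D) : Prop :=
  forall a b : C, bijective (fun f : mor a b => fmor F f).

Definition is_iso (C : category) (a b : C) (f : mor a b) : Prop :=
  exists g : mor b a, cmp g f = mor_id a /\ cmp f g = mor_id b.

Definition is_terminal (C : category) (t : C) : Prop :=
  forall x : C, exists f : mor x t, forall g : mor x t, g = f.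

Definition is_pullback (C : category) (A B M P : C) (f : mor A M) (g : mor B M)
    (p : mor P A) (q : mor P B) : Prop :=
  cmp f p = cmp g q /\
  forall (X : C) (u : mor X A) (v : mor X B), cmp f u = cmp g v ->
  exists w : mor X P, [/\ cmp p w = u, cmp q w = v &
    forall w' : mor X P, cmp p w' = u -> cmp q w' = v -> w' = w].

Definition is_cone (J C : category) (D : functor J C) (L : C)
    (pi : forall j : J, mor L (D j)) : Prop :=
  forall (j k : J) (u : mor j k), cmp (fmor D u) (pi j) = pi k.

Definition is_limit (J C : category) (D : functor J C) (L : C)
    (pi : forall j : J, mor L (D j)) : Prop :=
  is_cone pi /\
  forall (X : C) (rho : forall j : J, mor X (D j)), is_cone rho ->
  exists w : mor X L, (forall j, cmp (pi j) w = rho j) /\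
    forall w' : mor X L, (forall j, cmp (pi j) w' = rho j) -> w' = w.

(* [finite_set] would bound the universe of the objects of a category below
   that of [topologicalType]. *)
Definition finitely_many (T : Type) : Prop :=
  exists n (e : 'I_n -> T), forall x : T, exists i, e i = x.

Definition finite_category (J : category) : Prop :=
  finitely_many J /\ forall j k : J, finitely_many (mor j k).

Lemma fcomp_id (C D E : category) (G : functor D E) (F : functor C D) (a : C) :
  fmor G (fmor F (mor_id a)) = mor_id (G (F a)).
Proof. by rewrite !fmor_id. Qed.

Lemma fcomp_cmp (C D E : category) (G : functor D E) (F : functor C D)
    (a b c : C) (g : mor b c) (f : mor a b) :
  fmor G (fmor F (cmp g f)) = cmp (fmor G (fmor F g)) (fmor G (fmor F f)).
Proof. by rewrite !fmor_cmp. Qed.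

Definition fcomp (C D E : category) (G : functor D E) (F : functor C D) :
    functor C E :=
  @Functor C E (fun a => G (F a)) (fun a b f => fmor G (fmor F f))
    (fcomp_id G F) (fcomp_cmp G F).

Definition preserves_finite_limits (C D : category) (F : functor C D) : Prop :=
  forall (J : category) (G : functor J C) (L : C)
    (pi : forall j : J, mor L (G j)),
  finite_category J -> is_limit pi ->
  @is_limit J D (fcomp F G) (F L) (fun j => fmor F (pi j)).

Record cgspace : Type := CGSpace {
  cg_space :> topologicalType;
  cg_hausdorff : hausdorff_space cg_space;
  cg_closed : forall A : set cg_space,
    (forall K : set cg_space, compact K -> closed (A `&` K)) -> closed A }.

Record cgmap (X Y : cgspace) : Type := CGMap {
  cg_fun :> X -> Y;
  cg_cont : continuous cg_fun }.

Lemma cgmap_eq (X Y : cgspace) (f g : cgmap X Y) : (f : X -> Y) = g -> f = g.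
Proof.
by case: f g => [f cf] [g cg] /= E; subst g; congr CGMap; exact: Prop_irrelevance.
Qed.

Definition cg_id (X : cgspace) : cgmap X X := @CGMap X X id (fun x => @cvg_id _ _).

Lemma cg_comp_cont (X Y Z : cgspace) (g : cgmap Y Z) (f : cgmap X Y) :
  continuous (g \o f).
Proof. by move=> x; apply: continuous_comp; exact: cg_cont. Qed.

Definition cg_comp (X Y Z : cgspace) (g : cgmap Y Z) (f : cgmap X Y) :
  cgmap X Z := @CGMap X Z (g \o f) (@cg_comp_cont X Y Z g f).

Lemma cg_idl (X Y : cgspace) (f : cgmap X Y) : cg_comp (cg_id Y) f = f.
Proof. exact: cgmap_eq. Qed.

Lemma cg_idr (X Y : cgspace) (f : cgmap X Y) : cg_comp f (cg_id X) = f.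
Proof. exact: cgmap_eq. Qed.

Lemma cg_compA (X Y Z T : cgspace) (h : cgmap Z T) (g : cgmap Y Z)
    (f : cgmap X Y) :
  cg_comp h (cg_comp g f) = cg_comp (cg_comp h g) f.
Proof. exact: cgmap_eq. Qed.

Definition CG : category :=
  @Category cgspace cgmap cg_id cg_comp cg_idl cg_idr cg_compA.

(* The local model of an n-manifold: R^n if [b = false], and the half-space
   where coordinate 0 is nonnegative if [b = true] (a single point if n = 0). *)
Definition model (R : realType) (b : bool) (n : nat) : set 'rV[R]_n :=
  [set x | b -> forall i : 'I_n, i = 0%N :> nat -> 0 <= x 0 i].

Arguments model {R} b n _.

Definition model_boundary (R : realType) (n : nat) : set 'rV[R]_n :=
  [set x | exists i : 'I_n, i = 0%N :> nat /\ x 0 i = 0].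

(* [cto] and [cinv] are total functions, meaningful on [cdom] and [cimg]. *)
Record chart (R : realType) (b : bool) (T : topologicalType) (n : nat) : Type :=
  Chart {
  cdom : set T;
  cimg : set 'rV[R]_n;
  cto : T -> 'rV[R]_n;
  cinv : 'rV[R]_n -> T;
  cdom_open : open cdom;
  cimg_open : exists2 O : set 'rV[R]_n, open O & cimg = O `&` model b n;
  cto_img : forall x, cdom x -> cimg (cto x);
  cinv_dom : forall y, cimg y -> cdom (cinv y);
  ctoK : forall x, cdom x -> cinv (cto x) = x;
  cinvK : forall y, cimg y -> cto (cinv y) = y;
  cto_cont : {within cdom, continuous cto};
  cinv_cont : {within cimg, continuous cinv} }.

(* Smooth manifolds, with boundary if [b = true] and without if [b = false],
   given by a (not necessarily maximal) smooth atlas. *)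
Record manifold (R : realType) (b : bool) : Type := Manifold {
  mspace :> topologicalType;
  mdim : nat;
  atlas : set (chart R b mspace mdim);
  m_hausdorff : hausdorff_space mspace;
  m_countable : @second_countable mspace;
  m_cover : forall x : mspace, exists2 c, atlas c & cdom c x;
  m_compat : forall c d, atlas c -> atlas d ->
    smooth_on (cimg c `&` cinv c @^-1` cdom d) (cto d \o cinv c) }.

Arguments mdim {R b} _.
Arguments atlas {R b} _ _.

Definition boundary (R : realType) (W : manifold R true) : set W :=
  [set x | exists c, [/\ atlas W c, cdom c x & model_boundary (cto c x)]].

Arguments boundary {R} W _.

Definition smooth_map (R : realType) (b b' : bool) (M : manifold R b)
    (N : manifold R b') (f : M -> N) : Prop :=
  continuous f /\
  forall c d, atlas M c -> atlas N d ->
    smooth_on (cimg c `&` (f \o cinv c) @^-1` cdom d) (cto d \o f \o cinv c).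

Definition diff_at (R : realType) (b : bool) (M : manifold R false)
    (N : manifold R b) (f : M -> N) (c : chart R false M (mdim M))
    (d : chart R b N (mdim N)) (x : M) : 'rV[R]_(mdim M) -> 'rV[R]_(mdim N) :=
  'd (cto d \o f \o cinv c) (cto c x).

Definition immersion (R : realType) (b : bool) (M : manifold R false)
    (N : manifold R b) (f : M -> N) : Prop :=
  forall x c d, atlas M c -> cdom c x -> atlas N d -> cdom d (f x) ->
    injective (diff_at f c d x).

Definition embedding (R : realType) (b : bool) (M : manifold R false)
    (N : manifold R b) (f : M -> N) : Prop :=
  [/\ smooth_map f, immersion f, injective f &
      forall U : set M, open U -> exists2 V : set N, open V & U = f @^-1` V].

Definition transverse (R : realType) (A B M : manifold R false) (f : A -> M)
    (g : B -> M) : Prop :=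
  forall x y c d e, f x = g y ->
    atlas A c -> cdom c x -> atlas B d -> cdom d y -> atlas M e -> cdom e (f x) ->
    forall v, exists u w, v = diff_at f c e x u + diff_at g d e y w.

Section ManifoldTheory.
Variable R : realType.

Lemma smooth_map_id (b : bool) (M : manifold R b) : smooth_map (@id M).
Proof. by split=> [x|c d]; [exact: cvg_id|exact: m_compat]. Qed.

Lemma smooth_map_comp (b1 b2 b3 : bool) (M : manifold R b1) (N : manifold R b2)
    (P : manifold R b3) (g : N -> P) (f : M -> N) :
  smooth_map g -> smooth_map f -> smooth_map (g \o f).
Proof.
move=> [cg sg] [cf sf]; split=> [x|c e Mc Pe y0 [cy0 ey0]].
  by apply: continuous_comp; [exact: cf|exact: cg].
have [d Nd dy0] := m_cover (f (cinv c y0)).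
have [U1 [f1 [oU1 Uy0 Cf1 Ef1]]] := sf c d Mc Nd y0 (conj cy0 dy0).
have Sg : (cimg d `&` (g \o cinv d) @^-1` cdom e)
    (cto d (f (cinv c y0))).
  by split; [exact: cto_img|rewrite /= ctoK].
have [U2 [g2 [oU2 Uy2 Cg2 Eg2]]] := sg d e Nd Pe _ Sg.
have nd : nbhs y0 [set y | cimg c y -> cdom d (f (cinv c y))].
  have /subspace_continuousP/(_ y0 cy0) ci := @cinv_cont _ _ _ _ c.
  have : nbhs (cinv c y0) (f @^-1` cdom d).
    apply: cf; apply: open_nbhs_nbhs; split=> //; exact: cdom_open.
  by move=> /ci.
pose V := [set y | cimg c y -> cdom d (f (cinv c y))]° `&`
          (U1 `&` f1 @^-1` U2).
have oV1 : open (U1 `&` f1 @^-1` U2).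
  rewrite openE => y [Uy U2y]; apply: filterI.
    exact: open_nbhs_nbhs.
  by apply: (Cf1 0%N y Uy); exact: open_nbhs_nbhs.
have oV : open V by apply: openI => //; exact: open_interior.
exists V, (g2 \o f1); split=> //.
- split=> //; split=> //=.
  by rewrite -Ef1 //; split.
- move=> k; apply: (Ck_comp oV oU2) => //.
  + by move=> y [_ []].
  + by apply: Ck_sub (Cf1 k) => y [_ []].
- move=> y [/= cy ey] [/interior_subset dy [Uy U2y]].
  have {}dy := dy cy.
  have Efy := Ef1 y (conj cy dy) Uy; rewrite /= in Efy.
  have Sy : (cimg d `&` (g \o cinv d) @^-1` cdom e) (cto d (f (cinv c y))).
    by split; [exact: cto_img|rewrite /= ctoK].
  have := Eg2 _ Sy; rewrite /= ctoK // -Efy => -> //.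
  by rewrite Efy.
Qed.

Record smap (M N : manifold R false) : Type := SMap {
  sm_fun :> M -> N;
  sm_smooth : smooth_map sm_fun }.

Lemma smap_eq (M N : manifold R false) (f g : smap M N) :
  (f : M -> N) = g -> f = g.
Proof.
by case: f g => [f sf] [g sg] /= E; subst g; congr SMap; exact: Prop_irrelevance.
Qed.

Definition smap_id (M : manifold R false) : smap M M :=
  SMap (@smooth_map_id false M).

Definition smap_comp (M N P : manifold R false) (g : smap N P) (f : smap M N) :
  smap M P :=
  @SMap M P (g \o f) (smooth_map_comp (sm_smooth g) (sm_smooth f)).

Lemma smap_idl (M N : manifold R false) (f : smap M N) :
  smap_comp (smap_id N) f = f.
Proof. exact: smap_eq. Qed.

Lemma smap_idr (M N : manifold R false) (f : smap M N) :
  smap_comp f (smap_id M) = f.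
Proof. exact: smap_eq. Qed.

Lemma smap_compA (M N P Q : manifold R false) (h : smap P Q) (g : smap N P)
    (f : smap M N) :
  smap_comp h (smap_comp g f) = smap_comp (smap_comp h g) f.
Proof. exact: smap_eq. Qed.

Definition Man : category :=
  @Category (manifold R false) smap smap_id smap_comp smap_idl smap_idr
    smap_compA.

End ManifoldTheory.

Section EuclideanPoint.
Variable R : realType.

Lemma rV0_countable : @second_countable 'rV[R]_0.
Proof.
exists [set setT]; first exact: countable1.
split=> [U ->|x U Ux]; first exact: openT.
exists setT => //= y _.
by rewrite (_ : y = x); [exact: nbhs_singleton Ux|rewrite (thinmx0 x) thinmx0].
Qed.

Lemma rV0_img : exists2 O : set 'rV[R]_0, open O & setT = O `&` model false 0.
Proof. by exists setT; [exact: openT|rewrite setTI; apply/seteqP; split]. Qed.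

Lemma rV0_cont : {within [set: 'rV[R]_0], continuous (@id 'rV[R]_0)}.
Proof. by apply: continuous_subspaceT => x; exact: cvg_id. Qed.

Definition rV0_chart : chart R false 'rV[R]_0 0 :=
  @Chart R false 'rV[R]_0 0 setT setT id id openT rV0_img
    (fun _ _ => I) (fun _ _ => I) (fun _ _ => erefl) (fun _ _ => erefl)
    rV0_cont rV0_cont.

Lemma rV0_cover (x : 'rV[R]_0) : exists2 c, [set rV0_chart] c & cdom c x.
Proof. by exists rV0_chart. Qed.

Lemma rV0_compat (c d : chart R false 'rV[R]_0 0) :
  [set rV0_chart] c -> [set rV0_chart] d ->
  smooth_on (cimg c `&` cinv c @^-1` cdom d) (cto d \o cinv c).
Proof.
move=> -> -> x _; exists setT, (fun=> 0); split=> //; first exact: openT.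
  by move=> k; apply: Ck_cst; exact: openT.
by move=> y _ _; exact: thinmx0.
Qed.

Definition R0 : Man R :=
  @Manifold R false 'rV[R]_0 0 [set rV0_chart] (@norm_hausdorff _ _)
    rV0_countable rV0_cover rV0_compat.

End EuclideanPoint.

(* A geometric simplicial category, in the discrete case: homotopy terminal
   objects, homotopy pullbacks and equivalences are terminal objects, pullbacks
   and isomorphisms, and discrete mapping spaces are automatically Kan. *)
Record geometric_category (R : realType) (C : category) : Type := Geometric {
  geo_i : functor (Man R) C;
  geo_i_ff : fully_faithful geo_i;
  geo_i_transverse : forall (A B M : Man R) (f : mor A M) (g : mor B M),
    transverse f g ->
    (exists (Q : C) (p : mor Q (geo_i A)) (q : mor Q (geo_i B)),
       is_pullback (fmor geo_i f) (fmor geo_i g) p q) /\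
    forall (P : Man R) (p : mor P A) (q : mor P B), is_pullback f g p q ->
    forall (Q : C) (p' : mor Q (geo_i A)) (q' : mor Q (geo_i B)),
      is_pullback (fmor geo_i f) (fmor geo_i g) p' q' ->
    forall h : mor (geo_i P) Q,
      cmp p' h = fmor geo_i p -> cmp q' h = fmor geo_i q -> is_iso h;
  geo_i_terminal : is_terminal (geo_i (R0 R));
  geo_U : functor C CG;
  (* a natural homeomorphism between U (i M) and the underlying space of M *)
  geo_Ui : forall M : Man R, geo_U (geo_i M) -> M;
  geo_Ui_inv : forall M : Man R, M -> geo_U (geo_i M);
  geo_Ui_cont : forall M, continuous (@geo_Ui M);
  geo_Ui_inv_cont : forall M, continuous (@geo_Ui_inv M);
  geo_UiK : forall M, cancel (@geo_Ui M) (@geo_Ui_inv M);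
  geo_Ui_invK : forall M, cancel (@geo_Ui_inv M) (@geo_Ui M);
  geo_Ui_natural : forall (M N : Man R) (f : mor M N) (x : geo_U (geo_i M)),
    @geo_Ui N (fmor geo_U (fmor geo_i f) x) = f (@geo_Ui M x);
  geo_U_lim : preserves_finite_limits geo_U }.

(* Compact manifolds over T. *)
Record cman (R : realType) (T : Man R) : Type := CMan {
  cman_man :> manifold R false;
  cman_map : @mor (Man R) cman_man T;
  cman_compact : compact [set: cman_man] }.

Definition disjoint_union (R : realType) (T : Man R) (A B S : cman T) : Prop :=
  exists (a : @mor (Man R) A S) (b : @mor (Man R) B S),
    [/\ mdim A = mdim S,
        mdim B = mdim S,
        embedding a & embedding b] /\
    [/\ range a `&` range b = set0, range a `|` range b = setT,
        cmp (cman_map S) a = cman_map A & cmp (cman_map S) b = cman_map B].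

Definition cobordant (R : realType) (T : Man R) (A B : cman T) : Prop :=
  exists (W : manifold R true) (F : W -> T) (a : A -> W) (b : B -> W),
    [/\ compact [set: W], smooth_map F,
        mdim W = (mdim A).+1 & mdim W = (mdim B).+1] /\
    [/\ embedding a /\ embedding b,
        range a `&` range b = set0, range a `|` range b = boundary W,
        forall x, F (a x) = cman_map A x & forall y, F (b y) = cman_map B y].

(* Rings not assumed to have a unit: the unit of the cobordism ring over T is
   the class of the identity of T, which exists only when T is compact. *)
Record rng : Type := Rng {
  rng_group :> zmodType;
  rmul : rng_group -> rng_group -> rng_group;
  rmulA : associative rmul;
  rmulDl : left_distributive rmul +%R;
  rmulDr : right_distributive rmul +%R }.

Definition is_unit (K : rng) (e : K) : Prop :=
  forall x : K, rmul e x = x /\ rmul x e = x.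

(* The unoriented cobordism ring over T, that is, the direct sum over k of the
   groups of cobordism classes of compact k-manifolds over T. Addition is
   disjoint union; the product is the fiber product of transverse
   representatives, which determines it by Thom transversality. *)
Record cobordism_ring (R : realType) (T : Man R) : Type := CobordismRing {
  cob_rng :> rng;
  cob_cls : cman T -> cob_rng;
  cob_eq : forall (N : nat) (A B : 'I_N -> cman T),
    (forall k, mdim (A k) = k) ->
    (forall k, mdim (B k) = k) ->
    \sum_k cob_cls (A k) = \sum_k cob_cls (B k) <->
    forall k, cobordant (A k) (B k);
  cob_gen : forall x : cob_rng, exists (N : nat) (A : 'I_N -> cman T),
    (forall k, mdim (A k) = k) /\ x = \sum_k cob_cls (A k);
  cob_add : forall A B S : cman T, disjoint_union A B S ->
    cob_cls S = cob_cls A + cob_cls B;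
  cob_mul : forall (A B P : cman T) (p : @mor (Man R) P A)
      (q : @mor (Man R) P B),
    transverse (cman_map A) (cman_map B) ->
    is_pullback (cman_map A) (cman_map B) p q ->
    cman_map P = cmp (cman_map A) p ->
    cob_cls P = rmul (cob_cls A) (cob_cls B) }.

(* Compact objects of C over i(T), compactness being that of the underlying
   space. *)
Record cobj (R : realType) (C : category) (G : geometric_category R C)
    (T : Man R) : Type := CObj {
  cobj_ob :> C;
  cobj_map : mor cobj_ob (geo_i G T);
  cobj_compact : compact [set: geo_U G cobj_ob] }.

Section CupProduct.
Variables (R : realType) (C : category) (G : geometric_category R C).

Lemma geo_i_compact (M : Man R) :
  compact [set: M] -> compact [set: geo_U G (geo_i G M)].
Proof.
move=> cM; rewrite (_ : setT = @geo_Ui_inv _ _ G M @` setT).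
  apply: continuous_compact => //; apply: continuous_subspaceT.
  exact: geo_Ui_inv_cont.
by apply/seteqP; split=> // x _; exists (geo_Ui x) => //; rewrite geo_UiK.
Qed.

Definition icobj (T : Man R) (A : cman T) : cobj G T :=
  @CObj R C G T (geo_i G (cman_man A)) (fmor (geo_i G) (cman_map A))
    (geo_i_compact (@cman_compact R T A)).

End CupProduct.

Record cup_product_formula (R : realType)
    (Omega : forall T : Man R, cobordism_ring T) (C : category) :
    Type := CupProductFormula {
  cup_geo :> geometric_category R C;
  cup_inter : forall (M A B : Man R) (a : mor A M) (b : mor B M),
    embedding a -> embedding b ->
    exists (P : C) (p : mor P (geo_i cup_geo A)) (q : mor P (geo_i cup_geo B)),
      is_pullback (fmor (geo_i cup_geo) a) (fmor (geo_i cup_geo) b) p q;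
  dcob : forall T : Man R, cobj cup_geo T -> cobj cup_geo T -> Prop;
  dcob_refl : forall T X, @dcob T X X;
  dcob_sym : forall T X Y, @dcob T X Y -> @dcob T Y X;
  dcob_trans : forall T X Y Z, @dcob T X Y -> @dcob T Y Z -> @dcob T X Z;
  dcob_extends : forall (T : Man R) (A B : cman T),
    cobordant A B -> dcob (icobj cup_geo A) (icobj cup_geo B);
  dring : Man R -> rng;
  dcls : forall T : Man R, cobj cup_geo T -> dring T;
  dcls_eq : forall (T : Man R) (X Y : cobj cup_geo T),
    dcls X = dcls Y <-> dcob X Y;
  istar : forall T : Man R, Omega T -> dring T;
  istar_add : forall T x y, @istar T (x + y) = istar x + istar y;
  istar_mul : forall T x y, @istar T (rmul x y) = rmul (istar x) (istar y);
  istar_unit : forall T : Man R, compact [set: T] ->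
    forall e : Omega T, is_unit e -> is_unit (istar e);
  istar_cls : forall (T : Man R) (A : cman T),
    istar (cob_cls (Omega T) A) = dcls (icobj cup_geo A);
  istar_inj : forall T, injective (@istar T);
  cup_formula : forall (M : Man R) (A B : cman M),
    embedding (cman_map A) -> embedding (cman_map B) ->
    forall (P : C) (p : mor P (geo_i cup_geo (cman_man A)))
      (q : mor P (geo_i cup_geo (cman_man B)))
      (cP : compact [set: geo_U cup_geo P]),
    is_pullback (fmor (geo_i cup_geo) (cman_map A))
                (fmor (geo_i cup_geo) (cman_map B)) p q ->
    rmul (dcls (icobj cup_geo A)) (dcls (icobj cup_geo B)) =
    dcls (@CObj R C cup_geo M P (cmp (fmor (geo_i cup_geo) (cman_map A)) p) cP) }.

Definition has_cup_product_formula (R : realType)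
    (Omega : forall T : Man R, cobordism_ring T) (C : category) : Prop :=
  inhabited (cup_product_formula Omega C).

(* Main.v *)
(* In a discrete category [C], the point [pt = i(R^0)] is terminal, so every map
   [f : pt -> i(line)] is a split monomorphism and its pullback along itself is
   [pt]: the cup product formula makes the class of a point of the line
   idempotent. In the classical cobordism ring, points [0] and [1] of the line
   are cobordant through the unit interval and have empty intersection, so the
   square of that class is 0. Hence the class itself vanishes, that is, some
   compact 1-manifold has exactly one boundary point.

   The latter is excluded by a parity argument. For [h : W -> bool] locally
   constant off a finite set, count modulo 2 the points where [h] changes
   value, counting the end as one change if [h] is true near it. The
   count is additive for exclusive or and vanishes for functions supported in
   one chart, by comparing the values at both ends of the real line. Splitting
   the constant [true] along a finite cover by arcs, its count is 0; but it is 1,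
   coming from the unique end. *)
Require Import Defs.
From mathcomp Require Import all_boot all_order all_algebra.
From mathcomp Require Import all_classical all_reals.
From mathcomp Require Import topology normedtype derive lra.

Set Implicit Arguments.
Unset Strict Implicit.
Unset Printing Implicit Defensive.

Import Order.TTheory GRing.Theory Num.Theory.
Import numFieldNormedType.Exports.

Local Open Scope classical_set_scope.
Local Open Scope ring_scope.

(** * Jumps of boolean functions *)

Definition loc_cst (T : topologicalType) (h : T -> bool) (x : T) :=
  \forall y \near x, h y = h x.

(** The value at [x] is ignored, so that it does not matter to which side a cut point belongs. *)
Definition jump (T : topologicalType) (h : T -> bool) (x : T) : bool :=
  ~~ `[< exists b, \forall y \near x^', h y = b >].

Lemma jump_cst (T : topologicalType) (h : T -> bool) x b :
  (\forall y \near x^', h y = b) -> jump h x = false.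
Proof. by move=> hb; apply/negbF/asboolP; exists b. Qed.

Lemma loc_cst_near (T : topologicalType) (h : T -> bool) x b :
  (\forall y \near x, h y = b) -> loc_cst h x.
Proof. by move=> hb; rewrite /loc_cst (nbhs_singleton hb). Qed.

Lemma loc_cst_jump (T : topologicalType) (h : T -> bool) x :
  loc_cst h x -> jump h x = false.
Proof. by move=> hx; apply: (@jump_cst _ _ _ (h x)); exact: cvg_within hx. Qed.

Lemma loc_cst2 (T : topologicalType) (o : bool -> bool -> bool)
    (h1 h2 : T -> bool) x :
  loc_cst h1 x -> loc_cst h2 x -> loc_cst (fun y => o (h1 y) (h2 y)) x.
Proof. by apply: filterS2 => y -> ->. Qed.

Lemma near_notin (T : topologicalType) (x : T) (S : seq T) :
  hausdorff_space T -> \forall y \near x^', y \notin S.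
Proof.
move=> hT; elim: S => [|z S IH]; first exact: nearW.
have [zx|/eqP zx] := eqVneq z x; first subst z.
  near=> y; rewrite inE negb_or; apply/andP; split; last by near: y.
  by near: y; exact: nbhs_dnbhs_neq.
have zN : \forall y \near x^', y <> z.
  apply: nbhs_dnbhs; apply: open_nbhs_nbhs; split; last by move=> E; apply: zx.
  by apply: closed_openC; apply: accessible_closed_set1; exact: hausdorff_accessible.
near=> y.
rewrite inE negb_or; apply/andP; split; last by near: y.
by apply/eqP; near: y.
Unshelve. all: by end_near. Qed.

(** * Counting jumps on the real line *)

Section RealLine.
Variable R : realType.
Implicit Types (h : R -> bool) (t : R) (S : seq R).

(** Connectedness: the set where [h] takes the value [h t0] is open and closed in [I]. *)
Lemma loc_cst_interval h (I : set R) : is_interval I ->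
  (forall t, I t -> loc_cst h t) -> exists c, forall t, I t -> h t = c.
Proof.
move=> /connected_intervalP cI hI.
have [[t0 It0]|I0] := pselect (I !=set0); last first.
  by exists true => t It; case: I0; exists t.
exists (h t0).
pose B := I `&` [set t | h t = h t0].
suff BI : B = I by move=> t; rewrite -{1}BI => -[].
apply: cI; first by exists t0.
  exists [set t | h t = h t0]°; first exact: open_interior.
  apply/seteqP; split=> t [It].
    by move=> E; split=> //; rewrite /interior/=; move: (hI t It); rewrite /loc_cst E.
  by move=> /nbhs_singleton.
exists (~` [set t | h t <> h t0]°); first by apply: open_closedC; exact: open_interior.
apply/seteqP; split=> t [It].
  by move=> E; split=> // /nbhs_singleton.
move=> nE; split=> //; apply: contrapT => E; apply: nE.
by move: (hI t It); apply: filterS => y /= ->.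
Qed.

Lemma loc_cst_right h t : (\forall y \near t^'+, loc_cst h y) ->
  exists c, \forall y \near t^'+, h y = c.
Proof.
rewrite /at_right near_withinE => -[e /= e0 he].
have [||c hc] := @loc_cst_interval h `]t, (t + e)[.
- exact: interval_is_interval.
- move=> y; rewrite /= in_itv/= => /andP[ty yte]; apply: he => //=.
  by rewrite ltr0_norm ?subr_lt0// opprB ltrBlDl.
- exists c; near=> y; apply: hc; rewrite /= in_itv/=; apply/andP; split.
    by near: y; exact: nbhs_right_gt.
  by near: y; apply: nbhs_right_lt; rewrite ltrDl.
Unshelve. all: by end_near. Qed.

Lemma loc_cst_left h t : (\forall y \near t^'-, loc_cst h y) ->
  exists c, \forall y \near t^'-, h y = c.
Proof.
rewrite /at_left near_withinE => -[e /= e0 he].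
have [||c hc] := @loc_cst_interval h `](t - e), t[.
- exact: interval_is_interval.
- move=> y; rewrite /= in_itv/= => /andP[ty yte]; apply: he => //=.
  by rewrite gtr0_norm ?subr_gt0// ltrBlDl -ltrBlDr.
- exists c; near=> y; apply: hc; rewrite /= in_itv/=; apply/andP; split.
    by near: y; apply: nbhs_left_gt; rewrite gtrBl.
  by near: y; exact: nbhs_left_lt.
Unshelve. all: by end_near. Qed.

Lemma near_dnbhs t (P : set R) :
  (\forall y \near t^', P y) <->
  (\forall y \near t^'-, P y) /\ (\forall y \near t^'+, P y).
Proof.
rewrite /dnbhs /at_left /at_right !near_withinE; split=> [tP|[lP rP]].
  split; near=> y => yt; have : y != t -> P y by near: y.
    by apply; rewrite lt_eqF.
  by apply; rewrite gt_eqF.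
near=> y => /=; rewrite neq_lt => /orP[]; near: y; [exact: lP|exact: rP].
Unshelve. all: by end_near. Qed.

(** Expresses the jump as the sum modulo 2 of the one-sided limits, the form in which jumps add and
    telescope. *)
Lemma jump_sides h t (a b : bool) : (\forall y \near t^'-, h y = a) ->
  (\forall y \near t^'+, h y = b) -> jump h t = a (+) b.
Proof.
move=> ha hb; have [ab|nab] := eqVneq a b.
  subst b; rewrite addbb; apply: (@jump_cst _ _ _ a).
  exact/near_dnbhs.
rewrite (_ : a (+) b = true); last by move: a b nab {ha hb} => [] [].
apply/negP => /asboolP[c /near_dnbhs[hl hr]].
have [y1 []] := @filter_ex _ (t^'-) _ _ (filterI ha hl) => -> ac.
have [y2 []] := @filter_ex _ (t^'+) _ _ (filterI hb hr) => -> bc.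
by move: nab; rewrite ac bc eqxx.
Qed.

Lemma jump_addb h1 h2 t : (\forall y \near t^', loc_cst h1 y) ->
  (\forall y \near t^', loc_cst h2 y) ->
  jump (fun y => h1 y (+) h2 y) t = jump h1 t (+) jump h2 t.
Proof.
move=> /near_dnbhs[/loc_cst_left[a1 l1] /loc_cst_right[b1 r1]].
move=> /near_dnbhs[/loc_cst_left[a2 l2] /loc_cst_right[b2 r2]].
rewrite (jump_sides l1 r1) (jump_sides l2 r2).
rewrite (@jump_sides _ _ (a1 (+) a2) (b1 (+) b2)).
- by rewrite !addbA; congr (_ (+) _); rewrite -!addbA; congr (_ (+) _); exact: addbC.
- by apply: filterS2 l1 l2 => y -> ->.
- by apply: filterS2 r1 r2 => y -> ->.
Qed.

(** Telescoping from the left: each jump is the difference of the values on two consecutive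
    intervals, the first value is [c], and the last one is [false]. *)
Lemma jump_sum_right h (M : R) S t0 c : path <%R t0 S ->
  (forall t, t0 < t -> t \notin S -> loc_cst h t) ->
  (\forall y \near t0^'+, h y = c) ->
  (forall t, M < t -> h t = false) ->
  \big[addb/false]_(t <- S) jump h t = c.
Proof.
move=> + + + hM; elim: S t0 c => [|t S IH] t0 c /=.
  move=> _ hc h0; rewrite big_nil.
  have [||d hd] := @loc_cst_interval h `]t0, +oo[.
  - exact: interval_is_interval.
  - by move=> t; rewrite /= in_itv/= andbT => /hc; apply.
  have dF : d = false.
    rewrite -(hd (Num.max t0 M + 1)).
      by apply: hM; rewrite ltr_pwDr// le_max lexx orbT.
    by rewrite /= in_itv/= andbT ltr_pwDr// le_max lexx.
  have [y [yc yt]] := @filter_ex _ (t0^'+) _ _ (filterI h0 (nbhs_right_gt t0)).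
  by rewrite -yc hd ?dF//= in_itv/= andbT.
move=> /andP[t0t pS] hc h0; rewrite big_cons.
have tS s : s \in S -> t < s by move/(order_path_min lt_trans)/allP : pS; exact.
have [||d hd] := @loc_cst_interval h `]t0, t[.
- exact: interval_is_interval.
- move=> s; rewrite /= in_itv/= => /andP[t0s st]; apply: hc => //.
  by rewrite inE negb_or lt_eqF//=; apply: contraTN st => /tS; rewrite -leNgt => /ltW.
have dc : d = c.
  have [y [yc [yt0 yt]]] := @filter_ex _ (t0^'+) _ _
    (filterI h0 (filterI (nbhs_right_gt t0) (nbhs_right_lt t0t))).
  by rewrite -yc hd//= in_itv/= yt0 yt.
have hl : \forall y \near t^'-, h y = c.
  near=> y; rewrite hd ?dc//= in_itv/=; apply/andP; split.
    by near: y; exact: nbhs_left_gt.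
  by near: y; exact: nbhs_left_lt.
have [b hr] : exists b, \forall y \near t^'+, h y = b.
  apply: loc_cst_right.
  have /near_dnbhs[_ tnS] := near_notin t (t :: S) (@Rhausdorff R).
  near=> y; apply: hc; last by near: y.
  by apply: lt_trans t0t _; near: y; exact: nbhs_right_gt.
(* The jump at [t] is [c (+) b], and the remaining ones add up to [b]. *)
rewrite (jump_sides hl hr) (IH t b) ?addbK//.
move=> s ts sS; apply: hc; first exact: lt_trans ts.
by rewrite inE negb_or sS gt_eqF.
Unshelve. all: by end_near. Qed.

Lemma jump_sum h (M : R) S : uniq S ->
  (forall t, t \notin S -> loc_cst h t) ->
  (forall t, M < `|t| -> h t = false) ->
  \big[addb/false]_(t <- S) jump h t = false.
Proof.
move=> uS hS hM; rewrite -(perm_big _ (permEl (perm_sort <=%R S)))/=.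
(* A starting point to the left of all of [S] and in the region where [h] is [false], so that the
   telescoping starts from [false]. *)
have [t0 t0S t0M] : exists2 t0, {in S, forall t, t0 < t} & t0 < - M.
  elim: S {uS hS} => [|s S [t0 t0S t0M]].
    by exists (- M - 1) => //; rewrite gtrBl.
  exists (Num.min t0 (s - 1)); last by rewrite gt_min t0M.
  move=> t; rewrite inE => /predU1P[->|/t0S tt0]; rewrite gt_min ?tt0//.
  by rewrite gtrBl ltr01 orbT.
apply: (@jump_sum_right _ M _ t0).
- rewrite path_min_sorted; last by apply/allP => t; rewrite mem_sort => /t0S.
  by rewrite lt_sorted_uniq_le sort_uniq uS sort_le_sorted.
- by move=> t _; rewrite mem_sort; exact: hS.
- near=> y; apply: hM; rewrite lter_normr; apply/orP; right.
  by rewrite ltrNr; near: y; exact: nbhs_right_lt.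
- by move=> t Mt; apply: hM; rewrite lter_normr Mt.
Unshelve. all: by end_near. Qed.

End RealLine.

(** * A compact space made of arcs cannot have exactly one end *)

(** A purely topological chart. The image is any subset of the line, which allows half-open
    intervals, and the inverse is continuous only within it. *)
Record line_chart (R : realType) (T : topologicalType) : Type := LineChart {
  lc_dom : set T;
  lc_img : set R;
  lc_to : T -> R;
  lc_inv : R -> T;
  lc_dom_open : open lc_dom;
  lc_toP : forall x, lc_dom x -> lc_img (lc_to x);
  lc_invP : forall t, lc_img t -> lc_dom (lc_inv t);
  lc_toK : forall x, lc_dom x -> lc_inv (lc_to x) = x;
  lc_invK : forall t, lc_img t -> lc_to (lc_inv t) = t;
  lc_to_cont : forall x, lc_dom x -> {for x, continuous lc_to};
  lc_inv_cont : {within lc_img, continuous lc_inv} }.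

(* [compact_cover] is only available for pointed spaces. *)
Lemma compact_finite_cover (T : topologicalType) (U : T -> set T) :
  compact [set: T] -> (forall x, nbhs x (U x)) ->
  exists X : seq T, forall z, exists2 x, x \in X & U x z.
Proof.
move=> cT nU; apply: contrapT => /forallNP nX.
pose B (X : seq T) := [set z | forall x, x \in X -> ~ U x z].
pose F := filter_from setT B.
have FF : ProperFilter F.
  apply: filter_from_proper; last first.
    move=> X _; have /existsNP[z nz] := nX X; exists z => x xX Uxz.
    by apply: nz; exists x.
  apply: filter_from_filter; first by exists [::].
  move=> X Y _ _; exists (X ++ Y) => // z nz.
  by split=> x xX; apply: nz; rewrite mem_cat xX ?orbT.
have [p [_ Fp]] := cT F FF filterT.
have Fp' : F (B [:: p]) by exists [:: p].
have [z [/(_ p) + Upz]] := Fp _ _ Fp' (nU p).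
by rewrite inE eqxx; exact.
Qed.

Section OneEnd.
Variables (R : realType) (T : topologicalType).
Hypothesis hT : hausdorff_space T.
Implicit Types (c : line_chart R T) (g : T -> bool) (x : T) (t : R) (S : seq T).

(** Extension by [false] off the image, so that a function supported in one chart becomes a function
    on the whole line. *)
Definition pull c g t : bool := `[< lc_img c t >] && g (lc_inv c t).

Lemma pull_addb c g1 g2 :
  pull c (fun y => g1 y (+) g2 y) = fun t => pull c g1 t (+) pull c g2 t.
Proof. by apply/funext => t; rewrite /pull andb_addr. Qed.

Lemma pull_near c t (P : set T) : lc_img c t -> nbhs (lc_inv c t) P ->
  \forall s \near t, lc_img c s -> P (lc_inv c s).
Proof.
move=> It; have /subspace_continuousP/(_ t It) ci := @lc_inv_cont _ _ c.
exact: ci.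
Qed.

Lemma pull_to c x g : lc_dom c x -> pull c g (lc_to c x) = g x.
Proof. by move=> cx; rewrite /pull asboolT ?lc_toK//; exact: lc_toP. Qed.

Lemma loc_cst_pull c g t : lc_img c t -> nbhs t (lc_img c) ->
  loc_cst g (lc_inv c t) -> loc_cst (pull c g) t.
Proof.
move=> It nt /(pull_near It) gt; near=> s.
have Is : lc_img c s by near: s.
by rewrite /pull !asboolT//=; move: Is; near: s.
Unshelve. all: by end_near. Qed.

(** At an interior point of the image the chart is a local homeomorphism, and its injectivity
    respects punctured neighbourhoods. *)
Lemma jump_pull c g x : lc_dom c x -> nbhs (lc_to c x) (lc_img c) ->
  jump (pull c g) (lc_to c x) = jump g x.
Proof.
move=> cx nx; have Ix := lc_toP cx.
rewrite /jump; congr (~~ _); apply/asbool_equiv_eq; split=> -[b hb]; exists b.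
  have /(lc_to_cont cx) xb := hb.
  have ndom : nbhs x (lc_dom c).
    by apply: open_nbhs_nbhs; split=> //; exact: lc_dom_open.
  move: xb; rewrite /dnbhs !near_withinE /= => xb; near=> y => yx.
  have cy : lc_dom c y by near: y.
  rewrite -(pull_to g cy).
  have : lc_to c y != lc_to c x -> pull c g (lc_to c y) = b by near: y.
  by apply; apply: contra_neq yx => /(congr1 (lc_inv c)); rewrite !lc_toK.
have : nbhs (lc_inv c (lc_to c x)) [set y | y != x -> g y = b].
  by rewrite lc_toK//; move: hb; rewrite /dnbhs near_withinE.
move=> /(pull_near Ix) hb'; rewrite /dnbhs near_withinE; near=> s => sx.
have Is : lc_img c s by near: s.
have : lc_img c s -> lc_inv c s != x -> g (lc_inv c s) = b by near: s.
move=> /(_ Is); rewrite /pull asboolT//=; apply.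
by apply: contra_neq sx => <-; rewrite lc_invK.
Unshelve. all: by end_near. Qed.

(* At the end [x0], the jump is that of the extension of g by [false] beyond
   the end of the half-line chart [c0]. *)
Definition endjump (c0 : line_chart R T) (x0 : T) g x : bool :=
  if x == x0 then jump (pull c0 g) (lc_to c0 x0) else jump g x.

(** The four conditions say that [c] contains the end only if it is [c0]; that its image can fail to
    be open only at the end; that points close to a point of the image are interior or exterior to
    the image, so that extension by [false] creates no new changes accumulating there; and that the
    image is locally compact. *)
Definition end_chart (c0 : line_chart R T) (x0 : T) c : Prop :=
  [/\ lc_dom c x0 -> c = c0,
      forall t, lc_img c t -> lc_inv c t <> x0 -> nbhs t (lc_img c),
      forall t, lc_img c t ->
        \forall s \near t^', nbhs s (lc_img c) \/ nbhs s (~` lc_img c) &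
      forall t, lc_img c t ->
        exists2 e, 0 < e & compact (`[t - e, t + e] `&` lc_img c)].

Section Charts.
Variables (c0 : line_chart R T) (x0 : T).
Hypothesis c0x0 : lc_dom c0 x0.

(** Turns both cases of [endjump] into the jump of one function on the line, where the counts are
    known. *)
Lemma endjump_pull c g x : end_chart c0 x0 c -> lc_dom c x ->
  endjump c0 x0 g x = jump (pull c g) (lc_to c x).
Proof.
move=> [cc0 nI _ _] cx; rewrite /endjump; case: eqVneq => [xx0|/eqP xx0].
  by subst x; rewrite -cc0.
by rewrite jump_pull//; apply: nI; [exact: lc_toP|rewrite lc_toK].
Qed.

Lemma loc_cst_pull_off c g S t : end_chart c0 x0 c -> x0 \in S ->
  (forall y, y \notin S -> loc_cst g y) ->
  lc_img c t -> t \notin [seq lc_to c x | x <- S & `[< lc_dom c x >]] ->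
  loc_cst (pull c g) t.
Proof.
move=> [cc0 nI _ _] x0S gS It tS.
have tnS : lc_inv c t \notin S.
  apply: contra tS => iS; apply/mapP; exists (lc_inv c t); last by rewrite lc_invK.
  by rewrite mem_filter iS andbT; apply/asboolP; exact: lc_invP.
apply: loc_cst_pull => //; last exact: gS.
by apply: nI => // E; move: tnS; rewrite E x0S.
Qed.

Lemma endjump_addb g1 g2 S c x : end_chart c0 x0 c -> lc_dom c x ->
  x0 \in S ->
  (forall y, y \notin S -> loc_cst g1 y) ->
  (forall y, y \notin S -> loc_cst g2 y) ->
  endjump c0 x0 (fun y => g1 y (+) g2 y) x =
  endjump c0 x0 g1 x (+) endjump c0 x0 g2 x.
Proof.
move=> ec cx x0S g1S g2S; rewrite !(endjump_pull _ ec cx) pull_addb.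
have It := lc_toP cx; have [_ _ sI _] := ec.
have tS := near_notin (lc_to c x) [seq lc_to c x | x <- S & `[< lc_dom c x >]]
             (@Rhausdorff R).
suff near_cst g : (forall y, y \notin S -> loc_cst g y) ->
    \forall s \near (lc_to c x)^', loc_cst (pull c g) s.
  by apply: jump_addb; exact: near_cst.
(* Off the finitely many points coming from [S], local constancy is inherited at interior points of
   the image, and the extension is [false] near exterior ones. *)
move=> gS; apply: filterS2 tS (sI _ It) => s sS [/nbhs_singleton Is|Is].
  exact: (loc_cst_pull_off ec x0S gS).
apply: (@loc_cst_near _ _ _ false); apply: filterS Is => u Iu.
by rewrite /pull asboolF.
Qed.

Lemma endjump_near0 g x : (\forall y \near x, g y = false) ->
  endjump c0 x0 g x = false.
Proof.
move=> gx; rewrite /endjump; case: eqVneq => [xx0|_]; last first.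
  by apply: loc_cst_jump; exact: loc_cst_near gx.
subst x; apply: loc_cst_jump; apply: (@loc_cst_near _ _ _ false).
have I0 := lc_toP c0x0.
have /(pull_near I0) : nbhs (lc_inv c0 (lc_to c0 x0)) [set y | g y = false].
  by rewrite lc_toK.
apply: filterS => s gs; rewrite /pull; have [Is|nIs] := pselect (lc_img c0 s).
  by rewrite gs// andbF.
by rewrite asboolF.
Qed.

Lemma lc_closed c (K : set R) : compact K -> K `<=` lc_img c ->
  closed (lc_inv c @` K).
Proof.
move=> cK KI; apply: compact_closed => //; apply: continuous_compact => //.
exact: continuous_subspaceW KI (@lc_inv_cont _ _ c).
Qed.

(** Read in the chart, [g] becomes a function on the line supported in the compact set [K], to which
    [jump_sum] applies. *)
Lemma endjump_sum_arc c (K : set R) g S : end_chart c0 x0 c ->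
  compact K -> K `<=` lc_img c -> (forall y, g y -> (lc_inv c @` K) y) ->
  uniq S -> x0 \in S -> (forall y, y \notin S -> loc_cst g y) ->
  \big[addb/false]_(x <- S) endjump c0 x0 g x = false.
Proof.
move=> ec cK KI gK uS x0S gS.
have clK := lc_closed cK KI.
(* Points of [S] outside the chart do not count, since [g] is [false] off the closed image of
   [K]. *)
rewrite (bigID (fun x => `[< lc_dom c x >]))/= [X in _ (+) X]big1 ?addbF; last first.
  move=> x /asboolPn ncx; apply: endjump_near0.
  have : nbhs x (~` (lc_inv c @` K)).
    apply: open_nbhs_nbhs; split; first exact: closed_openC.
    by move=> [t /KI It E]; apply: ncx; rewrite -E; exact: lc_invP.
  by apply: filterS => y; apply: contra_notF => /gK.
rewrite (eq_bigr (fun x => jump (pull c g) (lc_to c x))); last first.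
  by move=> x /asboolP cx; exact: endjump_pull.
rewrite -big_filter -(big_map (lc_to c) predT).
have pK t : pull c g t -> K t.
  move=> /andP[/asboolP It /gK[t' Kt' /(congr1 (lc_to c))]].
  by rewrite !lc_invK//; [move=> <-|exact: KI].
have [M [Mr KM]] : bounded_set K by exact: compact_bounded.
(* [KM] bounds [K] only by numbers strictly above [M], hence [M + 1]. *)
apply: (@jump_sum _ _ (M + 1)).
- rewrite map_inj_in_uniq ?filter_uniq// => x y.
  rewrite !mem_filter => /andP[/asboolP cx _] /andP[/asboolP cy _].
  by move=> /(congr1 (lc_inv c)); rewrite !lc_toK.
- move=> t tS; have [It|It] := pselect (lc_img c t).
    exact: loc_cst_pull_off tS.
  apply: (@loc_cst_near _ _ _ false).
  have : nbhs t (~` K).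
    apply: open_nbhs_nbhs; split; last by move/KI.
    by apply: closed_openC; apply: compact_closed => //; exact: Rhausdorff.
  by apply: filterS => s; apply: contra_notF => /pK.
- move=> t; apply: contraTF => /pK Kt; rewrite -leNgt.
  by apply: KM Kt; rewrite ltrDl.
Qed.

(** What [endjump_sum_arc] asks of functions cut out by [U]: finitely many changes, and a compact
    support in one chart. *)
Definition arc (U : set T) : Prop := exists E : seq T,
  (forall y, y \notin E -> loc_cst (fun z => `[< U z >]) y) /\
  exists c K, [/\ end_chart c0 x0 c, compact K, K `<=` lc_img c &
    U `<=` lc_inv c @` K].

(** The preimage of a small open interval works: its indicator can change only at the preimages of
    the two end points. *)
Lemma exists_arc c x : end_chart c0 x0 c -> lc_dom c x ->
  exists U, [/\ open U, U x & arc U].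
Proof.
move=> ec cx; have [_ _ _ /(_ _ (lc_toP cx))[e e0 cK]] := ec.
set s := lc_to c x in cK.
pose U := lc_dom c `&` lc_to c @^-1` `]s - e, s + e[.
have oU : open U.
  rewrite openE => y [cy sy]; apply: filterI.
    by apply: open_nbhs_nbhs; split=> //; exact: lc_dom_open.
  by apply: (lc_to_cont cy); apply: open_nbhs_nbhs; split.
exists U; split=> //.
  by split=> //=; rewrite in_itv/= gtrBl ltrDl e0.
pose K := `[s - e, s + e] `&` lc_img c.
have KI : K `<=` lc_img c by move=> t [].
have UK : U `<=` lc_inv c @` K.
  move=> y [cy sy]; exists (lc_to c y); last exact: lc_toK.
  by split; [exact: subset_itv_oo_cc sy|exact: lc_toP].
(* If an end point lies outside the image, [lc_inv] gives an arbitrary point there, and a larger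
   exceptional set does no harm. *)
exists [:: lc_inv c (s - e); lc_inv c (s + e)]; split=> [y yE|]; last by exists c, K.
have [Uy|nUy] := pselect (U y).
  apply: (@loc_cst_near _ _ _ true).
  by move: (oU); rewrite openE => /(_ y Uy); apply: filterS => z Uz; exact/asboolP.
apply: (@loc_cst_near _ _ _ false).
(* In the closed image of [K], only the preimages of the two end points can lie outside [U], and [y]
   is neither. *)
have : nbhs y (~` (lc_inv c @` K)).
  apply: open_nbhs_nbhs; split; first by apply: closed_openC; exact: lc_closed.
  move=> [t [/= tK It] E]; subst y; apply: nUy; split; first exact: lc_invP.
  move: yE tK; rewrite /= lc_invK// !in_itv/= !inE negb_or => /andP[E1 E2].
  rewrite !le_eqVlt => /andP[/predU1P[Et|->] /predU1P[Et'|->]] //.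
  - by rewrite Et eqxx in E1.
  - by rewrite Et eqxx in E1.
  - by rewrite Et' eqxx in E2.
by apply: filterS => z nz; apply/asboolPn => /UK.
Qed.

Lemma one_end_absurd : compact [set: T] ->
  (forall x, exists2 c, end_chart c0 x0 c & lc_dom c x) ->
  (forall b, ~ \forall s \near (lc_to c0 x0)^', `[< lc_img c0 s >] = b) -> False.
Proof.
move=> cT hc hx0.
pose U x := projT1 (cid (let: ex_intro2 c ec cx := hc x in exists_arc ec cx)).
have hU x : [/\ open (U x), U x x & arc (U x)] by rewrite /U; case: cid.
have [X TX] : exists X : seq T, forall z, exists2 x, x \in X & U x z.
  apply: compact_finite_cover cT _ => x; have [oU Ux _] := hU x.
  exact: open_nbhs_nbhs.
pose E x := projT1 (cid (let: And3 _ _ a := hU x in a)).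
have hE x : forall y, y \notin E x -> loc_cst (fun z => `[< U x z >]) y.
  by rewrite /E; case: cid => ? [].
pose S := undup (x0 :: flatten [seq E x | x <- X]).
have uS : uniq S by exact: undup_uniq.
have x0S : x0 \in S by rewrite mem_undup inE eqxx.
pose A (l : seq T) z := has (fun x => `[< U x z >]) l.
have AS l : {subset l <= X} -> forall y, y \notin S -> loc_cst (A l) y.
  elim: l => [|x l IH] lX y yS; first exact: nearW.
  apply: (@loc_cst2 _ orb); last first.
    by apply: IH => // z zl; apply: lX; rewrite inE zl orbT.
  apply: hE; apply: contra yS => yE; rewrite mem_undup inE.
  apply/orP; right; apply/flatten_mapP; exists x => //.
  by apply: lX; rewrite inE eqxx.
(* Adding one arc to a union adds, modulo 2, the part [g] of the arc outside the union, a function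
   supported in one chart. *)
have Al l : {subset l <= X} -> \big[addb/false]_(x <- S) endjump c0 x0 (A l) x = false.
  elim: l => [|x l IH] lX.
    by rewrite big1// => y _; apply: endjump_near0; exact: nearW.
  have lX' : {subset l <= X} by move=> z zl; apply: lX; rewrite inE zl orbT.
  have xX : {subset [:: x] <= X}.
    by move=> z; rewrite inE => /eqP->; apply: lX; rewrite inE eqxx.
  pose g z := `[< U x z >] && ~~ A l z.
  have gS y : y \notin S -> loc_cst g y.
    move=> yS; apply: (@loc_cst2 _ (fun a b => a && ~~ b)); last exact: AS.
    have := AS _ xX y yS; apply: filterS => z; rewrite /A/=.
    by rewrite !orbF.
  have -> : A (x :: l) = fun z => A l z (+) g z.
    by apply/funext => z; rewrite /g /A/=; case: asboolP; case: has.
  rewrite (eq_bigr (fun y => endjump c0 x0 (A l) y (+) endjump c0 x0 g y)); last first.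
    move=> y _; have [c ec cy] := hc y.
    by apply: (@endjump_addb _ _ S c) => //; exact: AS.
  rewrite big_split/= IH//=.
  have [_ _ [F [_ [c [K [ec cK KI UK]]]]]] := hU x.
  apply: (@endjump_sum_arc c K) => // y /andP[/asboolP Uy _]; exact: UK.
have := Al X (fun z => id).
have -> : A X = fun=> true.
  apply/funext => z; apply/hasP; have [x xX Uxz] := TX z.
  by exists x => //; exact/asboolP.
(* For the whole cover the function is constantly [true], so only the end can contribute; its jump
   is that of the indicator of the image of [c0], which [hx0] prevents from vanishing. *)
rewrite (bigD1_seq x0)//= big1 ?addbF; last first.
  move=> y yx0; rewrite /endjump (negbTE yx0); apply: (@jump_cst _ _ _ true).
  exact: nearW.
rewrite /endjump eqxx => /negbT; rewrite negbK => /asboolP[b hb].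
by apply: (hx0 b); apply: filterS hb => s; rewrite /pull andbT.
Qed.

End Charts.
End OneEnd.

(** * Curves with boundary *)

Section RowOne.
Variable R : realType.

Definition scalar_row (t : R) : 'rV[R]_1 := const_mx t.

Lemma scalar_rowE t : scalar_row t 0 0 = t. Proof. by rewrite mxE. Qed.

Lemma scalar_rowK (v : 'rV[R]_1) : scalar_row (v 0 0) = v.
Proof. by apply/matrixP => i j; rewrite mxE !ord1. Qed.

Lemma scalar_row_continuous : continuous scalar_row.
Proof.
move=> t; apply/cvg_ballP => e e0.
by exists e => // s ts; split=> // i j; rewrite !mxE.
Qed.

Lemma model1 (v : 'rV[R]_1) : model true 1 v <-> 0 <= v 0 0.
Proof.
split=> [|v0 _ i _]; first exact.
by rewrite ord1.
Qed.

Lemma model_boundary1 (v : 'rV[R]_1) : model_boundary v <-> v 0 0 = 0.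
Proof.
split=> [[i [_]]|v0]; first by rewrite ord1.
by exists 0.
Qed.

End RowOne.

Arguments scalar_row {R} t.

(** * Charts of a curve with boundary as charts valued in the line *)

Section ChartLine.
Variables (R : realType) (T : topologicalType) (c : chart R true T 1).
Variables (D : set T) (oD : open D).

Let dom := cdom c `&` D.
Let img := [set t | cimg c (scalar_row t) /\ D (cinv c (scalar_row t))].
Let to x := cto c x 0 0.
Let inv t := cinv c (scalar_row t).

Lemma chart_dom_open : open dom.
Proof. by apply: openI => //; exact: cdom_open. Qed.

Lemma chart_toP x : dom x -> img (to x).
Proof.
by move=> [cx Dx]; rewrite /img /to/= scalar_rowK ctoK//; split=> //; exact: cto_img.
Qed.

Lemma chart_invP t : img t -> dom (inv t).
Proof. by move=> [It Dt]; split=> //; exact: cinv_dom. Qed.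

Lemma chart_toK x : dom x -> inv (to x) = x.
Proof. by move=> [cx _]; rewrite /inv /to scalar_rowK ctoK. Qed.

Lemma chart_invK t : img t -> to (inv t) = t.
Proof. by move=> [It _]; rewrite /inv /to cinvK// scalar_rowE. Qed.

Lemma chart_to_cont x : dom x -> {for x, continuous to}.
Proof.
move=> [cx _]; apply: (@continuous_comp _ _ _ (cto c) (fun v : 'rV_1 => v 0 0)).
  have := @cto_cont _ _ _ _ c; rewrite continuous_open_subspace; last exact: cdom_open.
  by apply; exact/mem_set.
exact: coord_continuous.
Qed.

Lemma chart_near_inv t (P : set T) : cimg c (scalar_row t) -> nbhs (inv t) P ->
  \forall s \near t, cimg c (scalar_row s) -> P (inv s).
Proof.
move=> It nP; have /subspace_continuousP/(_ _ It) ci := @cinv_cont _ _ _ _ c.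
exact: (@scalar_row_continuous _ t _ (ci _ nP)).
Qed.

Lemma chart_inv_cont : {within img, continuous inv}.
Proof.
apply/subspace_continuousP => t [It Dt] P nP.
have := chart_near_inv It nP; rewrite /= /nbhs/= /within/=.
by apply: filterS => s Ps [] /Ps.
Qed.

(** Restricting to an open set [D] allows the end to be removed from a chart. *)
Definition chart_line : line_chart R T :=
  LineChart chart_dom_open chart_toP chart_invP chart_toK chart_invK
    chart_to_cont chart_inv_cont.

Lemma chart_line_ge0 t : lc_img chart_line t -> 0 <= t.
Proof.
by move=> [+ _]; have [O _ ->] := cimg_open c => -[_ /model1]; rewrite scalar_rowE.
Qed.

(** The image is relatively open in the half-line, being cut out by [O] and by the preimage of
    [D]. *)
Lemma chart_line_near t : lc_img chart_line t ->
  \forall s \near t, 0 <= s -> lc_img chart_line s.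
Proof.
move=> [It Dt]; have := chart_near_inv It (open_nbhs_nbhs (conj oD Dt)).
move: (It); have [O oO IE] := cimg_open c; rewrite IE => -[Ot _] nD.
have nO : nbhs t (scalar_row @^-1` O).
  by apply: scalar_row_continuous; exact: open_nbhs_nbhs.
apply: filterS2 nO nD => s Os Ds s0.
have Is : cimg c (scalar_row s).
  by rewrite IE; split=> //; apply/model1; rewrite scalar_rowE.
by split=> //; apply: Ds; rewrite -IE.
Qed.

Lemma chart_line_end c0 x0 : (lc_dom chart_line x0 -> chart_line = c0) ->
  (lc_img chart_line 0 -> lc_inv chart_line 0 = x0) ->
  end_chart c0 x0 chart_line.
Proof.
move=> cc0 I0.
(* An open set whose trace on the half-line is the image; hence 0 is the only point where the image
   can fail to be open. *)
pose P : set R := [set s : R | 0 <= s -> lc_img chart_line s]°.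
have oP : open P by exact: open_interior.
have PI s : P s -> 0 <= s -> lc_img chart_line s by move=> /interior_subset.
have IP t : lc_img chart_line t -> P t by exact: chart_line_near.
have nP s : P s -> 0 < s -> nbhs s (lc_img chart_line).
  move=> Ps s0; have : nbhs s P by exact: open_nbhs_nbhs.
  have : nbhs s `]0, +oo[%classic.
    by apply: open_nbhs_nbhs; split=> //=; rewrite in_itv/= s0.
  apply: filterS2 => u; rewrite /= in_itv/= andbT => u0 /PI; apply.
  exact: ltW.
split=> //.
- move=> t It tx0; apply: nP; first exact: IP.
  rewrite lt_neqAle chart_line_ge0// andbT; apply/eqP => t0; subst t.
  exact/tx0/I0.
- move=> t It; have /nbhs_dnbhs tP : nbhs t P.
    by apply: open_nbhs_nbhs; split=> //; exact: IP.
  apply: filterS2 tP (near_notin t [:: 0] (@Rhausdorff R)) => s Ps.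
  rewrite inE => s0; have [{}s0|s0'] := ltP 0 s; first by left; exact: nP.
  right; have : nbhs s `]-oo, 0[%classic.
    by apply: open_nbhs_nbhs; split=> //=; rewrite in_itv/= lt_neqAle s0.
  by apply: filterS => u; rewrite /= in_itv/= => u0 /chart_line_ge0; rewrite leNgt u0.
- move=> t It.
  have /nbhs_ballP[e /= e0 eP] : nbhs t P.
    by apply: open_nbhs_nbhs; split=> //; exact: IP.
  (* Half the radius keeps the closed segment inside the ball, so that the intersection is the
     segment cut by the closed half-line. *)
  exists (e / 2); first by rewrite divr_gt0.
  rewrite (_ : _ `&` _ = `[t - e / 2, t + e / 2] `&` `[0, +oo[).
    apply: compact_closedI; [exact: segment_compact|exact: interval_closed].
  apply/seteqP; split=> s [se Is]; split=> //.
    by rewrite /= in_itv/= andbT; exact: chart_line_ge0.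
  apply: PI; last by move: Is; rewrite /= in_itv/= andbT.
  apply: eP; move: se; rewrite /= in_itv/= /ball/= => /andP[s1 s2].
  by rewrite distrC ltr_distl; apply/andP; split; lra.
Qed.

End ChartLine.

(** A chart can take the coordinate 0 only at [x0]; so one chart around [x0], together with charts
    restricted to the complement of [x0], satisfies [end_chart]. *)
Lemma atlas1_one_end (R : realType) (T : topologicalType)
    (A : set (chart R true T 1)) (x0 : T) :
  hausdorff_space T -> compact [set: T] ->
  (forall x, exists2 c, A c & cdom c x) ->
  [set x | exists c, [/\ A c, cdom c x & model_boundary (cto c x)]] <> [set x0].
Proof.
move=> hT cT cov bT.
have bx0 c x : A c -> cdom c x -> cto c x 0 0 = 0 -> x = x0.
  move=> Ac cx cx0.
  have : [set x0] x by rewrite -bT; exists c; split=> //; exact/model_boundary1.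
  by [].
have [c0 [Ac0 c0x0 /model_boundary1 c00]] :
    exists c, [/\ A c, cdom c x0 & model_boundary (cto c x0)].
  by have : [set x0] x0 by []; rewrite -bT.
have inv0 c (D : set T) (oD : open D) : A c -> lc_img (chart_line c oD) 0 ->
    lc_inv (chart_line c oD) 0 = x0.
  move=> Ac [I0 D0]; apply: (bx0 c) => //; first exact: cinv_dom.
  by rewrite /= cinvK// scalar_rowE.
pose l0 := chart_line c0 openT.
have l00 : lc_to l0 x0 = 0 by [].
have l0x0 : lc_dom l0 x0 by split.
apply: (@one_end_absurd _ _ hT l0 x0 l0x0 cT).
- move=> x; have [->|/eqP xx0] := eqVneq x x0.
    by exists l0 => //; apply: chart_line_end => //; exact: inv0.
  have oD : open (~` [set x0]).
    apply: closed_openC; apply: accessible_closed_set1.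
    exact: hausdorff_accessible.
  have [c Ac cx] := cov x; exists (chart_line c oD); last by split.
  by apply: chart_line_end; [move=> [_ []]|exact: inv0].
(* Near 0 the image contains the positive side and misses the negative one. *)
- rewrite l00 => b /near_dnbhs[lb rb].
  have I0 : lc_img l0 0 by rewrite -l00; exact: lc_toP.
  have bF : b = false.
    have [s [<- s0]] := @filter_ex _ (0^'-) _ _ (filterI lb (nbhs_left_lt (0 : R))).
    by apply: asboolF => /chart_line_ge0; rewrite leNgt s0.
  have nI : \forall s \near 0^'+, 0 <= s -> lc_img l0 s.
    by apply: cvg_within; exact: chart_line_near.
  have [s [sb [sI s0]]] :=
    @filter_ex _ (0^'+) _ _ (filterI rb (filterI nI (nbhs_right_ge (0 : R)))).
  by move: sb; rewrite bF => /asboolP; apply; exact: sI.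
Qed.

(** The dimension is a field of [W] and can be replaced by 1 only once [W] is destructed, hence the
    preceding formulation in terms of an atlas. *)
Lemma curve_one_end (R : realType) (W : manifold R true) (x0 : W) :
  compact [set: W] -> mdim W = 1%N -> boundary W <> [set x0].
Proof.
case: W x0 => T n A hT sT cov compat x0 /= cT n1; subst n.
exact: atlas1_one_end.
Qed.

(** * The line and the unit interval *)

Section Affine.
Variable R : realType.

Lemma Ck_id (V : normedModType R) k (U : set V) : open U -> Ck k U (@id V).
Proof.
move=> oU; case: k => [|k] /=; first by move=> x _; exact: cvg_id.
split=> [x _|v]; first by have [] := @is_diff_id R V x.
by apply: Ck_eq (Ck_cst k v oU) => // x _; have [_ ->] := @is_diff_id R V x.
Qed.

Lemma smooth_on_Ck (V W : normedModType R) (S : set V) (f g : V -> W) :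
  (forall k, Ck k setT g) -> (forall y, S y -> f y = g y) -> smooth_on S f.
Proof.
by move=> Cg fg x Sx; exists setT, g; split=> //; [exact: openT|move=> y /fg].
Qed.

(** The coordinate measured from the end 0 or from the end 1 of the unit interval. The boolean
    treats both charts at once, and their transition maps are flips again. *)
Definition flip (b : bool) (t : R) : R := if b then 1 - t else t.

Lemma flip_addb b b' t : flip b' (flip b t) = flip (b' (+) b) t.
Proof. by case: b; case: b'; rewrite /flip /= ?subKr. Qed.

Lemma flipK b : involutive (flip b).
Proof. by move=> t; rewrite flip_addb addbb. Qed.

Lemma flip_continuous b : continuous (flip b).
Proof.
case: b => t; last exact: cvg_id.
by apply: cvgB; [exact: cvg_cst|exact: cvg_id].
Qed.

Definition flip_row b (v : 'rV[R]_1) : 'rV[R]_1 := scalar_row (flip b (v 0 0)).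

Lemma Ck_flip_row b k : Ck k setT (flip_row b).
Proof.
have oT := @openT 'rV[R]_1.
apply: Ck_rowP => // i.
have Cc := @Ck_coord R _ 1 k setT id 0 oT (Ck_id k oT).
case: b.
  apply: (@Ck_eq _ _ _ _ _ oT (fun v : 'rV[R]_1 => 1 + (-1) * v 0 0)).
    by move=> v _; rewrite mxE mulN1r.
  by apply: Ck_add => //; [exact: Ck_cst|apply: Ck_mul => //; exact: Ck_cst].
by apply: Ck_eq Cc => // v _; rewrite mxE.
Qed.

End Affine.

(** * Countability and separation for the line and its subspaces *)

Section SecondCountable.

Lemma second_countable_real (R : realType) : @second_countable R.
Proof.
pose B := [set `](ratr p.1 : R), (ratr p.2)[%classic | p in [set: rat * rat]].
exists B; first by apply: card_le_trans (card_image_le _ _) _; exact: countableP.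
split=> [_ [p _ <-]|x U /nbhs_ballP[e /= e0 eU]]; first exact: interval_open.
have [p] := @rat_in_itvoo R (x - e) x (ltac:(rewrite gtrBl//)).
rewrite in_itv/= => /andP[p1 p2].
have [q] := @rat_in_itvoo R x (x + e) (ltac:(rewrite ltrDl//)).
rewrite in_itv/= => /andP[q1 q2].
exists `](ratr p : R), (ratr q)[%classic.
  by split; [exists (p, q)|rewrite /= in_itv/= p2].
move=> y; rewrite /= in_itv/= => /andP[y1 y2]; apply: eU.
by rewrite /ball/= distrC ltr_distl; apply/andP; split; lra.
Qed.

Lemma second_countable_subtype (T : topologicalType) (A : set T) :
  @second_countable T -> @second_countable (set_type A).
Proof.
move=> [B cB [oB bB]].
exists [set set_val @^-1` U | U in B].
  exact: card_le_trans (card_image_le _ _) cB.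
split=> [_ [U BU <-]|x U].
  by exists U => //; exact: oB.
rewrite nbhsE => -[V [[V' oV' <-] V'x] VU].
have [W [BW Wx] WV'] := bB _ _ (open_nbhs_nbhs (conj oV' V'x)).
by exists (set_val @^-1` W); [split=> //; exists W|move=> y /WV' /VU].
Qed.

Lemma subtype_continuous (T X : topologicalType) (A : set T)
    (f : X -> set_type A) : continuous (set_val \o f) -> continuous f.
Proof. by move=> cf; apply/continuous_comp_initial. Qed.

Lemma set_val_continuous (T : topologicalType) (A : set T) :
  continuous (@set_val _ A).
Proof. exact: initial_continuous. Qed.

Lemma hausdorff_subtype (T : topologicalType) (A : set T) :
  hausdorff_space T -> hausdorff_space (set_type A).
Proof.
move=> hT x y xy; apply: val_inj; apply: hT => U V Ux Vy.
have [z [Uz Vz]] :=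
  xy _ _ (@set_val_continuous _ A x _ Ux) (@set_val_continuous _ A y _ Vy).
by exists (val z).
Qed.

End SecondCountable.

(** * The manifold structures and the cobordism between two points *)

Section LineAndInterval.
Variable R : realType.

Lemma smooth_const (b : bool) (N : manifold R b) (y : N) :
  smooth_map (fun _ : R0 R => y).
Proof.
split; first by move=> x; exact: cst_continuous.
move=> c d _ _; apply: (@smooth_on_Ck _ _ _ _ _ (fun=> cto d y)) => // k.
exact/Ck_cst/openT.
Qed.

(** The source is a single point with zero tangent space, so both injectivity conditions are
    automatic and an open set is empty or everything. *)
Lemma embedding_const (b : bool) (N : manifold R b) (y : N) :
  embedding (fun _ : R0 R => y).
Proof.
split; first exact: smooth_const.
- by move=> x c d _ _ _ _ u v _; rewrite (thinmx0 u) (thinmx0 v).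
- by move=> u v _; rewrite (thinmx0 u) (thinmx0 v).
- move=> U _; have [U0|nU0] := pselect (U 0).
    exists setT; first exact: openT.
    by apply/seteqP; split=> // u _; rewrite (thinmx0 u).
  exists set0; first exact: open0.
  by apply/seteqP; split=> // u; rewrite (thinmx0 u).
Qed.

Lemma continuous_coord00 : continuous (fun v : 'rV[R]_1 => v 0 0).
Proof. exact: coord_continuous. Qed.

Lemma line_img : exists2 O : set 'rV[R]_1, open O & setT = O `&` model false 1.
Proof. by exists setT; [exact: openT|rewrite setTI; apply/seteqP; split]. Qed.

Definition line_std_chart : chart R false R 1 :=
  @Chart R false R 1 setT setT scalar_row (fun v => v 0 0) openT line_img
    (fun _ _ => I) (fun _ _ => I) (fun x _ => scalar_rowE x)
    (fun v _ => scalar_rowK v)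
    (continuous_subspaceT (@scalar_row_continuous R))
    (continuous_subspaceT continuous_coord00).

Lemma line_cover (x : R) : exists2 c, [set line_std_chart] c & cdom c x.
Proof. by exists line_std_chart. Qed.

Lemma line_compat (c d : chart R false R 1) :
  [set line_std_chart] c -> [set line_std_chart] d ->
  smooth_on (cimg c `&` cinv c @^-1` cdom d) (cto d \o cinv c).
Proof.
move=> -> ->; apply: (@smooth_on_Ck _ _ _ _ _ id).
  by move=> k; apply: Ck_id; exact: openT.
by move=> v _; exact: scalar_rowK.
Qed.

Definition line : Man R :=
  @Manifold R false R 1 [set line_std_chart] (@Rhausdorff R)
    (@second_countable_real R) line_cover line_compat.

Let itv01 : set R := `[0, 1]%classic.

(** A retraction onto the interval: inverse charts are total functions and need values in the
    interval also off their images. *)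
Definition clamp (t : R) : R := Num.max 0 (Num.min 1 t).

Lemma clamp_in t : clamp t \in itv01.
Proof.
by rewrite inE /itv01/= in_itv/= le_max lexx/= ge_max ler01/= ge_min lexx.
Qed.

Definition to_itv (t : R) : set_type itv01 := SigSub (clamp_in t).

Lemma clamp_id t : 0 <= t <= 1 -> clamp t = t.
Proof. by move=> /andP[t0 t1]; rewrite /clamp (min_idPr t1) (max_idPr t0). Qed.

Lemma clamp_continuous : continuous clamp.
Proof.
move=> t; apply: (@continuous_max R R (cst 0) (cst 1 \min id) t).
  exact: cst_continuous.
by apply: continuous_min; [exact: cst_continuous|exact: cvg_id].
Qed.

Lemma itv01P (x : set_type itv01) : 0 <= val x <= 1.
Proof. by have := valP x; rewrite inE /itv01/= in_itv. Qed.

Lemma flip_itv (b : bool) (t : R) : 0 <= t <= 1 -> 0 <= flip b t <= 1.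
Proof. by case: b => //=; rewrite /flip => /andP[? ?]; apply/andP; split; lra. Qed.

Section IntervalChart.
Variable b : bool.

Let dom := [set x : set_type itv01 | flip b (val x) < 1].
Let img := [set v : 'rV[R]_1 | v 0 0 < 1] `&` model true 1.
Let to (x : set_type itv01) := scalar_row (flip b (val x)).
Let inv (v : 'rV[R]_1) := to_itv (flip b (v 0 0)).

Lemma itv_flip_val_continuous :
  continuous (fun x : set_type itv01 => flip b (val x)).
Proof.
move=> x; apply: (@continuous_comp _ _ _ (@set_val _ itv01)).
  exact: set_val_continuous.
exact: flip_continuous.
Qed.

Lemma itv_dom_open : open dom.
Proof.
have /continuousP := itv_flip_val_continuous.
by move=> /(_ [set t | t < 1]); apply; exact: open_lt.
Qed.

Lemma itv_img_open : exists2 O : set 'rV[R]_1, open O & img = O `&` model true 1.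
Proof.
exists [set v : 'rV[R]_1 | v 0 0 < 1] => //.
have /continuousP := continuous_coord00.
by move=> /(_ [set t | t < 1]); apply; exact: open_lt.
Qed.

Lemma itv_invE v : img v -> val (inv v) = flip b (v 0 0).
Proof.
move=> [/= v1 /model1 v0]; rewrite /inv /to_itv /= clamp_id//.
by apply: flip_itv; rewrite v0 ltW.
Qed.

Lemma itv_toP x : dom x -> img (to x).
Proof.
move=> dx; split; first by rewrite /= scalar_rowE.
by apply/model1; rewrite scalar_rowE; have /(flip_itv b)/andP[] := itv01P x.
Qed.

Lemma itv_invP v : img v -> dom (inv v).
Proof. by move=> iv; rewrite /dom /mkset itv_invE// flipK; case: iv. Qed.

Lemma itv_toK x : dom x -> inv (to x) = x.
Proof.
move=> dx; apply: val_inj; rewrite itv_invE; last exact: itv_toP.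
by rewrite /to scalar_rowE flipK.
Qed.

Lemma itv_invK v : img v -> to (inv v) = v.
Proof. by move=> iv; rewrite /to itv_invE// flipK scalar_rowK. Qed.

Lemma itv_to_cont : {within dom, continuous to}.
Proof.
apply: continuous_subspaceT => x.
apply: (@continuous_comp _ _ _ (fun x : set_type itv01 => flip b (val x)) scalar_row).
  exact: itv_flip_val_continuous.
exact: scalar_row_continuous.
Qed.

Lemma itv_inv_cont : {within img, continuous inv}.
Proof.
apply: continuous_subspaceT; apply: subtype_continuous => v.
apply: (@continuous_comp _ _ _ (fun v : 'rV[R]_1 => flip b (v 0 0)) clamp).
  apply: (@continuous_comp _ _ _ (fun v : 'rV[R]_1 => v 0 0) (flip b)).
    exact: continuous_coord00.
  exact: flip_continuous.
exact: clamp_continuous.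
Qed.

(** The chart omits the end 1 if [b] is [false] and the end 0 if [b] is [true]; the remaining end
    has coordinate 0. *)
Definition itv_chart : chart R true (set_type itv01) 1 :=
  Chart itv_dom_open itv_img_open itv_toP itv_invP itv_toK itv_invK
    itv_to_cont itv_inv_cont.

End IntervalChart.

Lemma itv_cover (x : set_type itv01) : exists2 c, range itv_chart c & cdom c x.
Proof.
have [x1|x1] := ltP (val x) 1; first by exists (itv_chart false); [exists false|].
by exists (itv_chart true); [exists true|rewrite /= /flip gtrBl (lt_le_trans ltr01)].
Qed.

(** The transition maps are affine, and their formula on the whole line serves as the smooth
    extension. *)
Lemma itv_compat (c d : chart R true (set_type itv01) 1) :
  range itv_chart c -> range itv_chart d ->
  smooth_on (cimg c `&` cinv c @^-1` cdom d) (cto d \o cinv c).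
Proof.
move=> [b _ <-] [b' _ <-].
apply: (@smooth_on_Ck _ _ _ _ _ (flip_row (b' (+) b))); first exact: Ck_flip_row.
by move=> v [iv _]; rewrite /flip_row -flip_addb -itv_invE.
Qed.

Definition interval_manifold : manifold R true :=
  @Manifold R true (set_type itv01) 1 (range itv_chart)
    (@hausdorff_subtype R itv01 (@Rhausdorff R))
    (@second_countable_subtype R itv01 (@second_countable_real R)) itv_cover itv_compat.

Lemma interval_compact : compact [set: interval_manifold].
Proof.
rewrite (_ : setT = to_itv @` itv01).
  apply: continuous_compact; last exact: segment_compact.
  by apply: continuous_subspaceT; apply: subtype_continuous; exact: clamp_continuous.
apply/seteqP; split=> // x _; exists (val x); first by have := valP x; rewrite inE.
by apply: val_inj; rewrite /= clamp_id// itv01P.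
Qed.

Definition interval_to_line (x : interval_manifold) : line := val x.

Lemma interval_to_line_smooth : smooth_map interval_to_line.
Proof.
split; first exact: set_val_continuous.
move=> c d [b _ <-] ->.
apply: (@smooth_on_Ck _ _ _ _ _ (flip_row b)); first exact: Ck_flip_row.
by move=> v [iv _]; rewrite /flip_row -itv_invE.
Qed.

Lemma rV0_compact : compact [set: R0 R].
Proof.
rewrite (_ : setT = [set 0]); first exact: compact_set1.
by apply/seteqP; split=> // x _; rewrite (thinmx0 x).
Qed.

Definition line_point (t : R) : cman line :=
  @CMan R line (R0 R) (SMap (@smooth_const false line t)) rV0_compact.

Lemma val_to_itv0 : val (to_itv 0) = 0.
Proof. by rewrite /= clamp_id// lexx ler01. Qed.

Lemma val_to_itv1 : val (to_itv 1) = 1.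
Proof. by rewrite /= clamp_id// lexx ler01. Qed.

Lemma interval_boundary :
  boundary interval_manifold = [set to_itv 0; to_itv 1].
Proof.
apply/seteqP; split=> [x [_ [[b _ <-] _ /model_boundary1]]|_ [] ->].
- rewrite scalar_rowE => /(congr1 (flip b)); rewrite flipK => x0.
  case: b x0 => x0; [right|left]; apply: val_inj.
    by rewrite val_to_itv1 x0 /flip subr0.
  by rewrite val_to_itv0 x0.
- have v0 : flip false (val (to_itv 0)) = 0 by rewrite val_to_itv0.
  exists (itv_chart false); split; first by exists false.
    by change (flip false (val (to_itv 0)) < 1); rewrite v0.
  by apply/model_boundary1; rewrite scalar_rowE.
- have v1 : flip true (val (to_itv 1)) = 0 by rewrite val_to_itv1 /flip subrr.
  exists (itv_chart true); split; first by exists true.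
    by change (flip true (val (to_itv 1)) < 1); rewrite v1.
  by apply/model_boundary1; rewrite scalar_rowE.
Qed.

Lemma line_points_cobordant : cobordant (line_point 0) (line_point 1).
Proof.
exists interval_manifold, interval_to_line, (fun=> to_itv 0), (fun=> to_itv 1).
have rc (t : interval_manifold) : range (fun _ : R0 R => t) = [set t].
  by apply/seteqP; split=> [_ [_ _ <-]|_ ->] //; exists 0.
split; split=> //.
- exact: interval_compact.
- exact: interval_to_line_smooth.
- by split; exact: embedding_const.
- rewrite !rc; apply/seteqP; split=> // x [/= -> /(congr1 val)].
  by rewrite val_to_itv0 val_to_itv1 => /esym/eqP; rewrite oner_eq0.
- by rewrite !rc interval_boundary.
- by move=> x; exact: val_to_itv0.
- by move=> x; exact: val_to_itv1.
Qed.

End LineAndInterval.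

(** * The empty manifold *)

Section EmptyManifold.
Variable R : realType.

Let void : topologicalType := set_type (set0 : set R).

Lemma void_absurd (x : void) : False.
Proof. by have := valP x; rewrite inE. Qed.

Lemma void_cover (x : void) : exists2 c : chart R false void 0, set0 c & cdom c x.
Proof. by case: (void_absurd x). Qed.

Lemma void_compat (c d : chart R false void 0) : set0 c -> set0 d ->
  smooth_on (cimg c `&` cinv c @^-1` cdom d) (cto d \o cinv c).
Proof. by []. Qed.

(** A dimension must be declared even without charts; 0 makes the empty manifold comparable with
    points in [cobordant]. *)
Definition empty_manifold : Man R :=
  @Manifold R false void 0 set0 (@hausdorff_subtype R set0 (@Rhausdorff R))
    (@second_countable_subtype R set0 (@second_countable_real R))
    void_cover void_compat.

Lemma empty_compact : compact [set: empty_manifold].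
Proof.
rewrite (_ : setT = set0); first exact: compact0.
by apply/seteqP; split=> // x; case: (void_absurd x).
Qed.

Definition from_empty_fun (M : Man R) (x : empty_manifold) : M :=
  match void_absurd x with end.

Lemma from_empty_smooth (M : Man R) : smooth_map (from_empty_fun M).
Proof. by split=> [x|c d []]; case: (void_absurd x). Qed.

Definition from_empty (M : Man R) : mor empty_manifold M :=
  SMap (from_empty_smooth M).

Lemma from_empty_unique (M : Man R) (f g : mor empty_manifold M) : f = g.
Proof. by apply/smap_eq/funext => x; case: (void_absurd x). Qed.

Definition empty_cman (T : Man R) : cman T := CMan (from_empty T) empty_compact.

Lemma disjoint_union_empty (T : Man R) :
  disjoint_union (empty_cman T) (empty_cman T) (empty_cman T).
Proof.
have emb : embedding (smap_id empty_manifold).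
  split; [exact: smooth_map_id| |by []|by move=> U oU; exists U].
  by move=> x; case: (void_absurd x).
have r0 : range (smap_id empty_manifold) = set0.
  by apply/seteqP; split=> // x; case: (void_absurd x).
exists (smap_id empty_manifold), (smap_id empty_manifold); split=> //.
split; [by rewrite r0 set0I| |exact: from_empty_unique..].
by rewrite r0 setU0; apply/seteqP; split=> // x; case: (void_absurd x).
Qed.

(** The empty manifold is the disjoint union of two copies of itself, so its class satisfies
    [x = x + x]. *)
Lemma cob_cls_empty (T : Man R) (K : cobordism_ring T) :
  cob_cls K (empty_cman T) = 0.
Proof.
have := cob_add K (disjoint_union_empty T).
by move/(congr1 (fun z => z - cob_cls K (empty_cman T))); rewrite subrr addrK.
Qed.

(* Transversality and the pullback condition are vacuous when the images are
   disjoint. *)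
Lemma cob_mul_disjoint (T : Man R) (K : cobordism_ring T) (A B : cman T) :
  (forall x y, cman_map A x <> cman_map B y) ->
  rmul (cob_cls K A) (cob_cls K B) = 0.
Proof.
move=> AB; rewrite -(cob_cls_empty K); symmetry.
apply: (@cob_mul _ _ K A B (empty_cman T) (from_empty _) (from_empty _)).
- by move=> x y c d e xy; case: (AB x y).
- split; first exact: from_empty_unique.
  move=> X u v uv.
  have X0 (x : X) : False.
    by apply: (AB (u x) (v x)); exact: (congr1 (fun f : smap X T => f x) uv).
  have sw : smooth_map (fun x : X => match X0 x return empty_manifold with end).
    by split=> [x|c d _ []]; case: (X0 x).
  exists (SMap sw); split.
  + by apply/smap_eq/funext => x; case: (X0 x).
  + by apply/smap_eq/funext => x; case: (X0 x).
  + by move=> w' _ _; apply/smap_eq/funext => x; case: (X0 x).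
- exact: from_empty_unique.
Qed.

(** In [cob_eq] the manifold with index [k] has dimension [k], so dimension 0 alone means families
    of length 1. *)
Lemma cob_cls_eq0 (T : Man R) (K : cobordism_ring T) (A B : cman T) :
  mdim A = 0%N -> mdim B = 0%N -> cob_cls K A = cob_cls K B <-> cobordant A B.
Proof.
move=> A0 B0.
have := @cob_eq _ _ K 1 (fun=> A) (fun=> B).
rewrite !big_ord1 => -> //; [|by move=> k; rewrite ord1..].
by split=> [/(_ ord0)|].
Qed.

End EmptyManifold.

(** * The class of a point of the line and the contradiction *)

Lemma line_point_not_null (R : realType) :
  ~ cobordant (line_point (0 : R)) (empty_cman (line R)).
Proof.
move=> [W [F [a [b [[cW _ W1 _] [_ _ bW _ _]]]]]].
(* The image of [b] is empty, so the boundary of [W] is the single point [a 0]. *)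
apply: (@curve_one_end _ W (a 0) cW W1); rewrite -bW.
apply/seteqP; split=> [y [[x _ <-]|[x]]|y ->].
- by rewrite (thinmx0 x).
- by case: (void_absurd x).
- by left; exists 0.
Qed.

(** A split monomorphism can be cancelled: two maps that agree after composition with [f] are equal,
    and either one is the mediating map. *)
Lemma pullback_mono_id (C : category) (A M : C) (f : mor A M) (r : mor M A) :
  cmp r f = mor_id A -> is_pullback f f (mor_id A) (mor_id A).
Proof.
move=> rf; split=> // X u v /(congr1 (cmp r)).
rewrite !cmpA rf !cmp_id_l => uv; exists u; split; rewrite ?cmp_id_l//.
by move=> w; rewrite cmp_id_l.
Qed.

Theorem proposition1p10 (R : realType)
    (Omega : forall T : Man R, cobordism_ring T) (C : category) :
  ~ has_cup_product_formula Omega C.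
Proof.
case=> G; pose K := Omega (line R); pose p := line_point (0 : R).
pose f := fmor (geo_i G) (cman_map p).
(* The retraction of [f] comes for free: [r] is the map to the terminal object, all of whose
   endomorphisms agree. *)
have [r r_uniq] := geo_i_terminal G (geo_i G (line R)).
have [i i_uniq] := geo_i_terminal G (geo_i G (R0 R)).
have pb : is_pullback f f (mor_id _) (mor_id _).
  apply: (@pullback_mono_id _ _ _ f r).
  by rewrite (i_uniq (cmp r f)) (i_uniq (mor_id _)).
have emb : embedding (cman_map p) by exact: embedding_const.
have idem : rmul (cob_cls K p) (cob_cls K p) = cob_cls K p.
  (* The self-intersection is computed in the derived ring and brought back by injectivity of
     [istar]. *)
  apply: (@istar_inj _ _ _ G); rewrite istar_mul !istar_cls.
  (* Compactness is taken from [icobj G p] itself, so that only the structure maps, [f] composed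
     with the identity and [f], remain to be compared. *)
  rewrite (cup_formula emb emb (@cobj_compact _ _ _ _ (icobj G p)) pb); congr dcls.
  by rewrite /icobj; congr CObj; rewrite cmp_id_r.
have p01 : cob_cls K p = cob_cls K (line_point 1).
  by apply/cob_cls_eq0 => //; exact: line_points_cobordant.
have p0 : cob_cls K p = 0.
  (* The second factor is moved to the point 1, away from the first. *)
  rewrite -idem {2}p01; apply: cob_mul_disjoint => x y /= /esym/eqP.
  by rewrite oner_eq0.
apply: (@line_point_not_null R); apply/(cob_cls_eq0 K) => //.
by rewrite cob_cls_empty.
Qed.
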